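(* Let $f:\mathbb{R}^d\to\mathbb{R}$ be continuously differentiable with $L$-Lipschitz continuous gradient, and let $f^*=\min_{x\in\mathbb{R}^d}f(x)$. Let $\delta_1>0$, $\epsilon_S\in(0,1)$, $l\in\mathbb{N}^+$ be such that $$\delta_S<\frac{c}{(c+1)^2},\qquad \left[(1-\delta_S)(1-\delta_1)-1+\frac{c}{(c+1)^2}\right]^{-1}>0,$$ where $\delta_S=e^{-\frac{\epsilon_S^2l}{2d\nu^2}}$ and $\nu=\max\left\{\frac{\|y\|_\infty}{\|y\|_2}:\ y=\nabla f(x)\text{ for some }x\in\mathbb{R}^d\right\}$. Apply the random-subspace quadratic regularisation algorithm described in the context to $f$, where $\|B_k\|_2\le B_{\max}$ for all $k$ and some constant $B_{\max}\ge0$, and where $\mathcal S$ is the distribution of $l\times d$ scaled sampling matrices. Let $\epsilon>0$ and suppose the algorithm runs for $N$ iterations with $$N\ \ge\ \left[(1-\delta_S)(1-\delta_1)-1+\frac{c}{(c+1)^2}\right]^{-1}\left[\frac{f(x_0)-f^*}{h(\epsilon,\alpha_0\gamma_1^{c+\tau_\alpha})}+\frac{\tau_\alpha}{1+c}\right],$$ where $$h(\epsilon,\alpha_0\gamma_1^{c+\tau_\alpha})=\frac{\theta(1-\epsilon_S)\epsilon^2}{2\alpha_{\max}}\left(\sqrt{d/l}\left(B_{\max}+\alpha_0^{-1}\gamma_1^{-c-\tau_\alpha}\right)+\kappa_T\right)^{-2}$$ and $\tau_\alpha=\left\lceil\log_{\gamma_1}\left(\min\{\alpha_{low}/\alpha_0,\,1/\gamma_2\}\right)\right\rceil$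 with $\alpha_{low}=\frac{1-\theta}{L+B_{\max}}$. Then $$\mathbb{P}(N\ge N_\epsilon)\ \ge\ 1-e^{-\frac{\delta_1^2}{2}(1-\delta_S)N},$$ where $N_\epsilon=\inf\{M:\min_{k\le M}\|\nabla f(x_k)\|_2\le\epsilon\}$.
   Context: Scaled sampling matrix: a random matrix $S=(S_{ij})\in\mathbb{R}^{l\times d}$ such that, independently for each $i\in\{1,\dots,l\}$, an index $j\in\{1,\dots,d\}$ is sampled uniformly at random and $S_{ij}=\sqrt{d/l}$, all other entries being zero. In the definition of $\nu$, only nonzero gradients $y$ are considered. Random-subspace quadratic regularisation algorithm. Choose a distribution $\mathcal S$ of random matrices in $\mathbb{R}^{l\times d}$ with $l\le d$, and constants $\gamma_1\in(0,1)$, $\gamma_2=\gamma_1^{-c}$ for some $c\in\mathbb{N}^+$ (positive integers), $\theta\in(0,1)$, $\alpha_{\max}>0$, $\kappa_T\ge0$, a starting point $x_0\in\mathbb{R}^d$, and $\alpha_0=\alpha_{\max}\gamma_1^p$ for some $p\in\mathbb{N}^+$. For $k=0,1,\dots$: (1) Draw $S_k\in\mathbb{R}^{l\times d}$ from $\mathcal S$ (independently of all previous iterations) and let $\hat m_k(\hat s)=f(x_k)+\langle S_k\nabla f(x_k),\hat s\rangle+\frac12\langle\hat s,S_kB_kS_k^T\hat s\rangle$, where $B_k\in\mathbb{R}^{d\times d}$ is a user-chosen positive semi-definite matrix ($B_k=0$ is allowed). Compute $\hat s_k\in\mathbb{R}^l$ by approximately minimising $\hat q_k(\hat s)=\hat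 m_k(\hat s)+\frac{1}{2\alpha_k}\|S_k^T\hat s\|_2^2$ such that $\|\nabla\hat q_k(\hat s_k)\|_2\le\kappa_T\|S_k^T\hat s_k\|_2$ and $\hat q_k(\hat s_k)\le\hat q_k(0)$. Set $s_k=S_k^T\hat s_k$. (2) Check the sufficient decrease condition $f(x_k)-f(x_k+s_k)\ge\theta[\hat m_k(0)-\hat m_k(\hat s_k)]$. (3) If it holds, set $x_{k+1}=x_k+s_k$, $\alpha_{k+1}=\min\{\alpha_{\max},\gamma_2\alpha_k\}$ (successful); otherwise $x_{k+1}=x_k$, $\alpha_{k+1}=\gamma_1\alpha_k$ (unsuccessful). *)

(* Defs.v *)
From HB Require Import structures.
From mathcomp Require Import all_boot all_order all_algebra.
From mathcomp Require Import all_classical all_reals all_analysis.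

Set Implicit Arguments.
Unset Strict Implicit.
Unset Printing Implicit Defensive.

Import Order.TTheory GRing.Theory Num.Theory.
Import numFieldNormedType.Exports.

Local Open Scope classical_set_scope.
Local Open Scope ring_scope.

Section vectors.
Context {R : realType}.

(* On matrices the library norm [`|x|] is the sup norm, so the Euclidean and
   spectral norms are introduced separately. *)
Definition dotv {n : nat} (u v : 'cV[R]_n) : R := \sum_i u i 0 * v i 0.

Definition l2norm {n : nat} (u : 'cV[R]_n) : R := Num.sqrt (dotv u u).

Definition opnorm2 {m n : nat} (A : 'M[R]_(m, n)) : R :=
  sup [set l2norm (A *m v) | v in [set v : 'cV[R]_n | l2norm v <= 1]].

Definition psdmx {n : nat} (A : 'M[R]_n) : Prop :=
  A^T = A /\ forall v : 'cV[R]_n, 0 <= dotv v (A *m v).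

Definition grad {n : nat} (g : 'cV[R]_n -> R) (x : 'cV[R]_n) : 'cV[R]_n :=
  \col_i 'D_(delta_mx i 0) g x.

Definition lipschitz_grad {n : nat} (g : 'cV[R]_n -> R) (L : R) : Prop :=
  forall x y, l2norm (grad g x - grad g y) <= L * l2norm (x - y).

Definition continuously_differentiable {n : nat} (g : 'cV[R]_n -> R) : Prop :=
  (forall x, differentiable g x) /\ continuous (grad g).

Definition is_max (A : set R) (m : R) : Prop := A m /\ ubound A m.
Definition is_min (A : set R) (m : R) : Prop := A m /\ lbound A m.

Definition is_nonuniformity {n : nat} (g : 'cV[R]_n -> R) (nu : R) : Prop :=
  is_max [set `|y| / l2norm y | y in range (grad g) `\ 0] nu.

End vectors.

Section random_matrices.
Context {R : realType} {disp : measure_display} {Omega : measurableType disp}.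
Variable P : probability Omega R.

Definition random_mx {m n : nat} (X : Omega -> 'M[R]_(m, n)) : Prop :=
  forall i j, measurable_fun [set: Omega] (fun w => X w i j).

Definition rv_events (X : Omega -> R) : set (set Omega) :=
  preimage_set_system [set: Omega] X measurable.

Definition mx_events {m n : nat} (X : Omega -> 'M[R]_(m, n)) :
    set (set Omega) :=
  \bigcup_i \bigcup_j rv_events (fun w => X w i j).

Definition independent_classes (F G : set (set Omega)) : Prop :=
  forall A B, F A -> G B -> (P (A `&` B) = P A * P B)%E.

Definition mutually_independent {l d : nat} (J : 'I_l -> Omega -> 'I_d) :
    Prop :=
  forall (I : {set 'I_l}) (A : 'I_l -> set 'I_d),
    P (\bigcap_(i in [set` I]) (J i @^-1` A i)) =
    (\prod_(i in I) P (J i @^-1` A i))%E.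

Definition uniform_index {d : nat} (J : Omega -> 'I_d) : Prop :=
  forall j : 'I_d, measurable (J @^-1` [set j]) /\
    P (J @^-1` [set j]) = (d%:R^-1 : R)%:E.

(* Rows are sampled with replacement: two rows may select the same column. *)
Definition scaled_sampling {l d : nat} (S : Omega -> 'M[R]_(l, d)) : Prop :=
  exists J : 'I_l -> Omega -> 'I_d,
    [/\ forall i, uniform_index (J i),
        mutually_independent J &
        forall w, S w = \matrix_(i, j)
          (if j == J i w then Num.sqrt (d%:R / l%:R) else 0)].

End random_matrices.

Section algorithm.
Context {R : realType} {l d : nat}.
Variable f : 'cV[R]_d -> R.

Definition model (x : 'cV[R]_d) (S : 'M[R]_(l, d)) (B : 'M[R]_d)
    (shat : 'cV[R]_l) : R :=
  f x + dotv (S *m grad f x) shat + dotv shat (S *m B *m S^T *m shat) / 2.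

Definition reg_model (x : 'cV[R]_d) (S : 'M[R]_(l, d)) (B : 'M[R]_d)
    (alpha : R) (shat : 'cV[R]_l) : R :=
  model x S B shat + (2 * alpha)^-1 * l2norm (S^T *m shat) ^+ 2.

Definition sufficient_decrease (theta : R) (x : 'cV[R]_d)
    (S : 'M[R]_(l, d)) (B : 'M[R]_d) (shat : 'cV[R]_l) : bool :=
  theta * (model x S B 0 - model x S B shat) <= f x - f (x + S^T *m shat).

Context {disp : measure_display} {Omega : measurableType disp}.
Variable P : probability Omega R.

(* Everything produced before the k-th matrix is drawn: all outputs of
   iterations 0, ..., k-1, including the iterates x_j, alpha_j for j <= k. *)
Definition history (x : nat -> Omega -> 'cV[R]_d) (alpha : nat -> Omega -> R)
    (S : nat -> Omega -> 'M[R]_(l, d)) (B : nat -> Omega -> 'M[R]_d)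
    (shat : nat -> Omega -> 'cV[R]_l) (k : nat) : set (set Omega) :=
  <<s (\bigcup_(j in `I_k.+1) (mx_events (x j) `|` rv_events (alpha j))) `|`
      (\bigcup_(j in `I_k)
         (mx_events (S j) `|` mx_events (B j) `|` mx_events (shat j))) >>.

(* The first N iterations, on the probability space (Omega, P). The choices
   B_k and shat_k may themselves be random and depend on the past and on S_k;
   values of the processes past iteration N are unconstrained. *)
Record quadratic_regularisation_run
    (distS : (Omega -> 'M[R]_(l, d)) -> Prop)
    (gamma1 gamma2 theta alphamax kappaT : R) (x0 : 'cV[R]_d) (alpha0 : R)
    (N : nat)
    (x : nat -> Omega -> 'cV[R]_d) (alpha : nat -> Omega -> R)
    (S : nat -> Omega -> 'M[R]_(l, d)) (B : nat -> Omega -> 'M[R]_d)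
    (shat : nat -> Omega -> 'cV[R]_l) : Prop := {
  run_measurable_iterates : forall k, (k <= N)%N ->
    random_mx (x k) /\ measurable_fun [set: Omega] (alpha k);
  run_measurable_choices : forall k, (k < N)%N ->
    [/\ random_mx (S k), random_mx (B k) & random_mx (shat k)];
  run_x0 : forall w, x 0%N w = x0;
  run_alpha0 : forall w, alpha 0%N w = alpha0;
  run_draw : forall k, (k < N)%N -> distS (S k);
  run_independent : forall k, (k < N)%N ->
    independent_classes P <<s mx_events (S k) >> (history x alpha S B shat k);
  run_psd : forall k w, (k < N)%N -> psdmx (B k w);
  run_stationary : forall k w, (k < N)%N ->
    l2norm (grad (reg_model (x k w) (S k w) (B k w) (alpha k w)) (shat k w))
      <= kappaT * l2norm ((S k w)^T *m shat k w);
  run_decrease : forall k w, (k < N)%N ->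
    reg_model (x k w) (S k w) (B k w) (alpha k w) (shat k w)
      <= reg_model (x k w) (S k w) (B k w) (alpha k w) 0;
  run_next_x : forall k w, (k < N)%N ->
    x k.+1 w =
      if sufficient_decrease theta (x k w) (S k w) (B k w) (shat k w)
      then x k w + (S k w)^T *m shat k w else x k w;
  run_next_alpha : forall k w, (k < N)%N ->
    alpha k.+1 w =
      if sufficient_decrease theta (x k w) (S k w) (B k w) (shat k w)
      then Num.min alphamax (gamma2 * alpha k w) else gamma1 * alpha k w
}.

(* [+oo] if no iterate has a gradient of norm at most [eps]. *)
Definition hitting_time (x : nat -> Omega -> 'cV[R]_d) (eps : R) (w : Omega) :
    \bar R :=
  ereal_inf [set M%:R%:E | M in [set M : nat |
    \big[Num.min/l2norm (grad f (x 0%N w))]_(k < M.+1)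
       l2norm (grad f (x k w)) <= eps]].

End algorithm.

Section constants.
Context {R : realType}.

Definition delta_sampling (l d : nat) (epsS nu : R) : R :=
  expR (- (epsS ^+ 2 * l%:R / (2 * d%:R * nu ^+ 2))).

Definition log_base (b z : R) : R := ln z / ln b.

Definition tau_alpha (gamma1 gamma2 alpha0 alphalow : R) : int :=
  Num.ceil (log_base gamma1 (Num.min (alphalow / alpha0) (1 / gamma2))).

Definition decrease_bound (l d : nat) (theta epsS alphamax Bmax kappaT : R)
    (eps a : R) : R :=
  theta * (1 - epsS) * eps ^+ 2 / (2 * alphamax) *
  (Num.sqrt (d%:R / l%:R) * (Bmax + a^-1) + kappaT) ^- 2.

Definition rate (c : nat) (deltaS delta1 : R) : R :=
  (1 - deltaS) * (1 - delta1) - 1 + c%:R / (c%:R + 1) ^+ 2.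

End constants.

(* Main.v *)
Require Import Defs.
From HB Require Import structures.
From mathcomp Require Import all_boot all_order all_algebra.
From mathcomp Require Import all_classical all_reals all_analysis.
From mathcomp Require Import ring lra zify.

Set Implicit Arguments.
Unset Strict Implicit.
Unset Printing Implicit Defensive.

Import Order.TTheory GRing.Theory Num.Theory.
Import numFieldNormedType.Exports.

Local Open Scope classical_set_scope.
Local Open Scope ring_scope.

(** Suppose the gradient stays above [eps] in norm during the first [N] steps.
Three counts then contradict each other.

Failures. On the sampled subspace the model is exact to first order and the
regularisation term pays for the second-order error of [f], so an iteration
fails only if [alpha_k > (1 - theta) / L], whatever was drawn. Hence [alpha_k]
is at least [alpha0 * gamma1 ^+ (c + tau)], and since one success undoes at
most [c] failures, at least [(N - tau - 1) / (c + 1)] iterations are successful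
([stepsize_bounds], [failures_le]).

Good draws. Given the past, a draw is good with probability at least
[1 - deltaS], so a Chernoff bound along the filtration of histories yields more
than [(1 - delta1) * (1 - deltaS) * N] good draws outside an event of the
required probability ([good_count_tail], [good_draws_tail]).

Decrease. A success with a good draw lowers [f] by [h]
([good_draw_decrease]); by the first two counts this happens often enough to
push [f] below its minimum ([few_good_iterations]).

The delicate point is the meaning of good. Let [g] be the gradient and [m_j] the
number of rows that selected column [j]. Two rows may select the same column, so
the norm of [S] can be as large as [sqrt d], and the inequality
[|S g|^2 >= (1 - epsS) |g|^2] does not give a decrease of [h]: the step may
spend itself on the columns drawn several times. Instead a draw is good when
[\sum_j G (m_j) g_j^2 >= (l / d) (1 - epsS) |g|^2] for a function [G], fixed by
the constants of the algorithm ([draw_statistic]), that gives more than [m] to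
the columns drawn once and less than [m] to those drawn often. It has two
properties.

First, a decrease below [h] forces the statistic below its threshold
([draw_statistic_lt]). If the tolerance [kappaT] is small, so is the residual
[g + B s + s / alpha] on the drawn columns, and a short step leaves too little
of [g] there. Otherwise test the residual against the vector with entries
[phi (m_j) g_j] for a bounded [phi], and bound each product by Young's
inequality. When [alpha^-1 + Bmax] exceeds the inverse of the smallest step size,
a small model decrease alone does not make the step short enough, and the bound
on the actual decrease given by the Lipschitz gradient has to be used as well
([bad_step_short]).

Secondly, the number of bad draws obeys the same bound as if [G] were the
identity ([few_bad_draws]). If [m] is binomial with parameters [l] and [1 / d],
then [G m] has at least the mean of [m] and is less spread out, so that
[exp (- x G m)] has at most the mean of [exp (- x m)] ([damped_mgf]); and the
numbers [m_j] are negatively dependent, so that the mean of a product over the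
columns is at most the product of the means ([sum_prod_load_le]). *)

(** * Elementary inequalities *)

Lemma derive_le0_le (R : realType) (psi dpsi : R -> R) (x : R) :
  0 <= x -> (forall t : R, is_derive t 1 psi (dpsi t)) ->
  (forall t, 0 <= t <= x -> dpsi t <= 0) -> psi x <= psi 0.
Proof.
move=> x0 psi' psi'0.
have psic : {within `[0, x], continuous psi}.
  apply: continuous_subspaceT => t; apply: differentiable_continuous.
  by apply/derivable1_diffP; apply: ex_derive.
have [c cx psiE] := MVT_segment x0 (fun t _ => psi' t) psic.
by rewrite -subr_le0 psiE subr0 mulr_le0_ge0// psi'0.
Qed.

Lemma expRN_le (R : realType) (x : R) :
  0 <= x -> expR (- x) <= 1 - x + x ^+ 2 / 2.
Proof.
move=> x0.
pose psi (t : R) := expR (- t) - (1 - t + t ^+ 2 / 2).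
have : psi x <= psi 0.
  apply: (@derive_le0_le _ psi (fun t => - expR (- t) - (- 1 + t))) => // [t|t _].
    rewrite /psi; apply: is_derive_eq.
    by rewrite !scaler1 /GRing.scale/=; field.
  by have := expR_ge1Dx (- t); lra.
by rewrite /psi oppr0 expR0; lra.
Qed.

Lemma prod_ge1B (R : realType) (I : Type) (r : seq I) (y : I -> R) :
  (forall i, 0 <= y i <= 1) -> 1 - \sum_(i <- r) y i <= \prod_(i <- r) (1 - y i).
Proof.
move=> y01; elim: r => [|i r IH]; first by rewrite !big_nil subr0.
rewrite !big_cons; have /andP[yi0 yi1] := y01 i.
have s0 : 0 <= \sum_(j <- r) y j by apply: sumr_ge0 => j _; case/andP: (y01 j).
have : (1 - y i) * (1 - \sum_(j <- r) y j) <= (1 - y i) * \prod_(j <- r) (1 - y j).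
  by apply: ler_wpM2l => //; rewrite subr_ge0.
apply: le_trans; nra.
Qed.

(** * Loads of uniformly drawn columns *)

(** Mean of [f] at the load of a given column, now [m], after one more of the [d]
columns has been drawn uniformly. *)
Definition throw {R : realType} (d : nat) (f : nat -> R) (m : nat) : R :=
  (1 - d%:R^-1) * f m + d%:R^-1 * f m.+1.

Definition load {l d : nat} (t : {ffun 'I_l -> 'I_d}) (j : 'I_d) : nat :=
  \sum_i (t i == j).

Definition fcons {l : nat} {T : Type} (j : T) (t : {ffun 'I_l -> T}) :
    {ffun 'I_l.+1 -> T} :=
  [ffun i => oapp t j (unlift ord0 i)].

Lemma sum_ffun_cons (V : nmodType) (T : finType) (l : nat)
    (H : {ffun 'I_l.+1 -> T} -> V) :
  \sum_t H t = \sum_j \sum_t H (fcons j t).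
Proof.
rewrite pair_big/= (reindex (fun jt : T * {ffun 'I_l -> T} => fcons jt.1 jt.2)) //=.
exists (fun t : {ffun 'I_l.+1 -> T} => (t ord0, [ffun i => t (lift ord0 i)])).
  move=> [j t] _ /=; rewrite ffunE unlift_none /=; congr pair.
  by apply/ffunP => i; rewrite !ffunE liftK.
move=> t _; apply/ffunP => i; rewrite !ffunE.
case: (unliftP ord0 i) => [k|] ->; rewrite /= ?ffunE //.
Qed.

Lemma load_cons (l d : nat) (j : 'I_d) (t : {ffun 'I_l -> 'I_d}) i :
  load (fcons j t) i = ((j == i) + load t i)%N.
Proof.
rewrite /load big_ord_recl ffunE unlift_none/=; congr addn.
by apply: eq_bigr => k _; rewrite ffunE liftK.
Qed.

Section balls.
Context {R : realType} (d : nat).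
Hypothesis d0 : (0 < d)%N.
Implicit Types f g : nat -> R.

(** Only one column receives the new row, so the left side is the product of the
[F i (m i)] times the average of one relative loss; independent draws for each
column give a product of losses, which is larger by [prod_ge1B]. *)
Lemma one_throw (F : 'I_d -> nat -> R) (m : 'I_d -> nat) :
  (forall j n, 0 < F j n) -> (forall j n, F j n.+1 <= F j n) ->
  \sum_j \prod_i F i (m i + (j == i))%N <= d%:R * \prod_i throw d (F i) (m i).
Proof.
move=> F0 Fdec.
pose y i := d%:R^-1 * (1 - F i (m i).+1 / F i (m i)).
have dR : 0 < d%:R :> R by rewrite ltr0n.
have dV1 : d%:R^-1 <= 1 :> R by rewrite invf_le1// ler1n.
have q01 i : 0 <= F i (m i).+1 / F i (m i) <= 1.
  apply/andP; split; last by rewrite ler_pdivrMr// mul1r.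
  by apply: divr_ge0; exact: ltW.
have y01 i : 0 <= y i <= 1.
  have /andP[q0 q1] := q01 i.
  rewrite mulr_ge0 ?invr_ge0 ?ler0n ?subr_ge0//=.
  by rewrite -[leRHS]mulr1 ler_pM ?invr_ge0 ?ler0n ?subr_ge0// lerBlDr lerDl.
have throwE i : throw d (F i) (m i) = F i (m i) * (1 - y i).
  rewrite /throw /y; have := F0 i (m i); have := dR; rewrite lt0r => /andP[? _].
  by rewrite lt0r => /andP[? _]; field; apply/andP.
under [X in _ <= _ * X]eq_bigr do rewrite throwE.
rewrite big_split/=.
have -> : \sum_j \prod_i F i (m i + (j == i))%N =
    \prod_i F i (m i) * \sum_j (F j (m j).+1 / F j (m j)).
  rewrite mulr_sumr; apply: eq_bigr => j _.
  rewrite (bigD1 j)//= [in RHS](bigD1 j)//= eqxx addn1.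
  have -> : \prod_(i < d | i != j) F i (m i + (j == i))%N =
            \prod_(i < d | i != j) F i (m i).
    by apply: eq_bigr => i ij; rewrite eq_sym (negbTE ij) addn0.
  by field; rewrite gt_eqF.
rewrite mulrCA ler_pM2l ?prodr_gt0// -ler_pdivrMl//.
apply: le_trans (prod_ge1B _ y01).
rewrite /y -mulr_sumr big_split/= sumrN sumr_const card_ord mulrBr.
by rewrite -[1 *+ d]/(d%:R) mulVf ?gt_eqF// opprB addrC subrK.
Qed.

Lemma invn01 : 0 <= (d%:R^-1 : R) <= 1.
Proof. by rewrite invr_ge0 ler0n/= invf_le1 ?ltr0n// ler1n. Qed.

Lemma iter_throw_gt0 l f : (forall m, 0 < f m) ->
  forall m, 0 < iter l (throw d) f m.
Proof.
move=> f0; elim: l => [|l IH] m //=; have /andP[dV0 dV1] := invn01.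
have := IH m; have := IH m.+1; rewrite /throw; move: (iter _ _ _) => h.
have [->|dV] := eqVneq (d%:R^-1 : R) 1; first by rewrite subrr mul0r mul1r add0r.
move=> h1 h2; apply: ltr_wpDr; first by rewrite mulr_ge0// ltW.
by rewrite mulr_gt0// subr_gt0 lt_neqAle dV.
Qed.

Lemma iter_throw_nincr l f : (forall m, f m.+1 <= f m) ->
  forall m, iter l (throw d) f m.+1 <= iter l (throw d) f m.
Proof.
move=> fn; elim: l => [|l IH] m //=; have /andP[dV0 dV1] := invn01.
by rewrite /throw lerD// ler_wpM2l// subr_ge0.
Qed.

Lemma iter_throw_le l f g : (forall m, f m <= g m) ->
  forall m, iter l (throw d) f m <= iter l (throw d) g m.
Proof.
move=> fg; elim: l => [|l IH] m //=; have /andP[dV0 dV1] := invn01.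
by rewrite /throw lerD// ler_wpM2l// subr_ge0.
Qed.

Lemma iter_throw_lin l (a b : R) f g m :
  iter l (throw d) (fun m => a * f m + b * g m) m =
  a * iter l (throw d) f m + b * iter l (throw d) g m.
Proof. by elim: l m => [|l IH] m //=; rewrite /throw !IH; ring. Qed.

Lemma iter_throw_geom l (q : R) m :
  iter l (throw d) (fun m => q ^+ m) m = (1 - d%:R^-1 * (1 - q)) ^+ l * q ^+ m.
Proof.
by elim: l m => [|l IH] m /=; rewrite ?mul1r// /throw !IH !exprS; ring.
Qed.

Lemma iter_throw_falling1 l m :
  iter l (throw d) (fun m => m%:R) m = m%:R + l%:R / d%:R :> R.
Proof.
by elim: l m => [|l IH] m /=; rewrite ?mul0r ?addr0// /throw !IH -!natr1; ring.
Qed.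

Lemma iter_throw_falling2 l m :
  iter l (throw d) (fun m => m%:R * (m%:R - 1)) m =
  m%:R * (m%:R - 1) + 2 * m%:R * (l%:R / d%:R)
  + l%:R / d%:R * ((l%:R - 1) / d%:R) :> R.
Proof.
elim: l m => [|l IH] m /=; first by ring.
by rewrite /throw !IH -!natr1; ring.
Qed.

Lemma iter_throw_falling3 l m :
  iter l (throw d) (fun m => m%:R * (m%:R - 1) * (m%:R - 2)) m =
  m%:R * (m%:R - 1) * (m%:R - 2) + 3 * (m%:R * (m%:R - 1)) * (l%:R / d%:R)
  + 3 * m%:R * (l%:R / d%:R * ((l%:R - 1) / d%:R))
  + l%:R / d%:R * ((l%:R - 1) / d%:R) * ((l%:R - 2) / d%:R) :> R.
Proof.
elim: l m => [|l IH] m /=; first by ring.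
by rewrite /throw !IH -!natr1; ring.
Qed.

(** Negative dependence of the loads: for positive nonincreasing functions the
mean of the product is at most the product of the binomial means
[iter l (throw d) (F j) (m j)]. The rows are added one at a time. *)
Lemma sum_prod_load_le l (F : 'I_d -> nat -> R) (m : 'I_d -> nat) :
  (forall j n, 0 < F j n) -> (forall j n, F j n.+1 <= F j n) ->
  \sum_(t : {ffun 'I_l -> 'I_d}) \prod_j F j (m j + load t j)%N <=
  d%:R ^+ l * \prod_j iter l (throw d) (F j) (m j).
Proof.
move=> F0 Fn; elim: l m => [|l IH] m.
  rewrite (bigD1 [ffun i : 'I_0 => Ordinal d0])//= [X in _ + X]big1.
    rewrite addr0 mul1r le_eqVlt; apply/orP; left; apply/eqP.
    by apply: eq_bigr => j _; rewrite /load big_ord0 addn0.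
  by move=> t /eqP[]; apply/ffunP => -[].
rewrite sum_ffun_cons exprS -mulrA mulrCA.
apply: (@le_trans _ _ (\sum_j d%:R ^+ l *
    \prod_i iter l (throw d) (F i) (m i + (j == i))%N)).
  apply: ler_sum => j _; apply: le_trans (IH _).
  by apply: ler_sum => t _; under eq_bigr do rewrite load_cons addnA.
rewrite -mulr_sumr ler_wpM2l ?exprn_ge0//.
by apply: one_throw => j n; [apply: iter_throw_gt0|apply: iter_throw_nincr].
Qed.

End balls.

(** * Lower tails of damped load statistics *)

Section lower_tail.
Context {R : realType} (l d : nat).
Hypothesis l0 : (0 < l)%N.
Hypothesis d0 : (0 < d)%N.

(** [G] lies above the identity up to some load and below it afterwards, while its
mean under the binomial law with parameters [l] and [1 / d] is at least that of
the identity, which is [l / d]. *)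
Record damped_load (G : nat -> R) : Prop := DampedLoad {
  damped_mono : forall m n, (m <= n)%N -> G m <= G n ;
  damped_cross : forall m n, (m <= n)%N -> G m < m%:R -> G n <= n%:R ;
  damped_mean : l%:R / d%:R <= iter l (throw d) G 0%N }.

(** By convexity of the exponential, [expR (- x m) - expR (- x G m)] is at least
[x (G m - m) expR (- x G m)]; as [G] is nondecreasing, the last factor may be
replaced by its value [g] at the load where [G] crosses the identity. *)
Lemma damped_expR (G : nat -> R) (x : R) : damped_load G -> 0 <= x ->
  exists2 g, 0 <= g & forall m,
    expR (- (x * G m)) <= (expR (- x)) ^+ m - x * g * (G m - m%:R).
Proof.
move=> [mono cross _] x0.
have [g g0 gP] : exists2 g, 0 <= g &
    forall m, 0 <= (G m - m%:R) * (expR (- (x * G m)) - g).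
  have [[m1 m1P]|noP] := pselect (exists m, G m < m%:R); last first.
    exists 0 => // m; rewrite subr0 mulr_ge0 ?expR_ge0// subr_ge0 leNgt.
    by apply/negP => Gm; apply: noP; exists m.
  have exP : exists m, G m < m%:R by exists m1.
  case: (ex_minnP exP) => m0 Gm0 m0min.
  exists (expR (- (x * G m0))); first exact: expR_ge0.
  move=> m; have [mm0|m0m] := ltnP m m0.
    apply: mulr_ge0; first by rewrite subr_ge0 leNgt; apply/negP => /m0min; rewrite leqNgt mm0.
    by rewrite subr_ge0 ler_expR lerN2 ler_wpM2l// mono// ltnW.
  apply: mulr_le0; first by rewrite subr_le0 (cross m0).
  by rewrite subr_le0 ler_expR lerN2 ler_wpM2l// mono.
exists g => // m; rewrite -expRM_natr.
have -> : - x * m%:R = - (x * G m) + x * (G m - m%:R) by ring.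
rewrite expRD; have := expR_ge1Dx (x * (G m - m%:R)); have := gP m.
have := expR_gt0 (- (x * G m)).
move: (expR (- _)) (expR (_ * (_ - _))) => e1 e2 e10 eg e2ge.
have : e1 * (1 + x * (G m - m%:R)) <= e1 * e2 by rewrite ler_pM2l.
have : 0 <= x * ((G m - m%:R) * (e1 - g)) by rewrite mulr_ge0.
nra.
Qed.

(** Since the mean of [G m - m] is nonnegative, the correction term of
[damped_expR] can be dropped, which leaves the generating function of the
binomial law. *)
Lemma damped_mgf (G : nat -> R) (x : R) : damped_load G -> 0 <= x ->
  iter l (throw d) (fun m => expR (- (x * G m))) 0%N <=
  expR (- (l%:R / d%:R * (x - x ^+ 2 / 2))).
Proof.
move=> dG x0; have [g g0 gP] := damped_expR dG x0.
apply: le_trans (iter_throw_le d0 l gP 0) _.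
have -> : (fun m => expR (- x) ^+ m - x * g * (G m - m%:R)) =
  (fun m => 1 * expR (- x) ^+ m + 1 * (- (x * g) * G m + x * g * m%:R)).
  by apply/funext => m; ring.
rewrite !iter_throw_lin iter_throw_geom iter_throw_falling1 expr0 !mul1r mulr1 add0r.
have mean := damped_mean dG.
apply: (@le_trans _ _ ((1 - d%:R^-1 * (1 - expR (- x))) ^+ l)).
  rewrite gerDl mulNr addrC subr_le0 ler_wpM2l// mulr_ge0//.
have -> : - (l%:R / d%:R * (x - x ^+ 2 / 2)) = - (d%:R^-1 * (x - x ^+ 2 / 2)) * l%:R :> R.
  by ring.
rewrite expRM_natr lerXn2r ?nnegrE ?expR_ge0//.
  have /andP[dV0 dV1] := @invn01 R _ d0.
  have := expR_gt0 (- x); nra.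
apply: le_trans (expR_ge1Dx _); rewrite lerD2l lerN2 ler_wpM2l//.
by have := expRN_le x0; lra.
Qed.

(** Chernoff's method with parameter [x j = eps v_j^2 / (nu^2 V)] in column [j]. *)
Lemma few_bad_draws (G : nat -> R) (v : 'I_d -> R) (nu eps : R) :
  damped_load G -> 0 < nu -> 0 <= eps ->
  let V := \sum_j v j ^+ 2 in
  0 < V -> (forall j, v j ^+ 2 <= nu ^+ 2 * V) ->
  #|[set t : {ffun 'I_l -> 'I_d} |
      \sum_j G (load t j) * v j ^+ 2 < l%:R / d%:R * (1 - eps) * V]%SET|%:R <=
  expR (- (eps ^+ 2 * l%:R / (2 * d%:R * nu ^+ 2))) * d%:R ^+ l.
Proof.
move=> dG nu0 eps0 V V0 vnu.
pose lam : R := l%:R / d%:R.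
have lR : 0 < l%:R :> R by rewrite ltr0n.
have dR : 0 < d%:R :> R by rewrite ltr0n.
pose x j := eps * v j ^+ 2 / (nu ^+ 2 * V).
have n2V : 0 < nu ^+ 2 * V by rewrite mulr_gt0// exprn_gt0.
have x0 j : 0 <= x j by rewrite divr_ge0 ?(ltW n2V)// mulr_ge0 ?sqr_ge0.
pose c := expR (eps * (1 - eps) * lam / nu ^+ 2).
have c0 : 0 < c by exact: expR_gt0.
apply: (@le_trans _ _ (\sum_(t : {ffun 'I_l -> 'I_d})
   c * \prod_j expR (- (x j * G (load t j))))).
  rewrite -sum1_card natr_sum/= big_mkcond/=; apply: ler_sum => t _.
  rewrite inE; case: ifPn => [bad|_]; last first.
    apply: mulr_ge0; first exact: ltW.
    by apply: prodr_ge0 => j _; exact: expR_ge0.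
  rewrite -expR_sum -expRD -[leLHS]expR0 ler_expR sumrN subr_ge0.
  have -> : \sum_j x j * G (load t j) =
     eps / (nu ^+ 2 * V) * \sum_j G (load t j) * v j ^+ 2.
    by rewrite mulr_sumr; apply: eq_bigr => j _; rewrite /x; ring.
  have -> : eps * (1 - eps) * lam / nu ^+ 2 =
      eps / (nu ^+ 2 * V) * (lam * (1 - eps) * V).
    by field; rewrite !gt_eqF.
  by apply: ler_wpM2l; [rewrite divr_ge0// ltW|exact: ltW].
rewrite -mulr_sumr.
apply: (@le_trans _ _ (c * (d%:R ^+ l *
    \prod_j iter l (throw d) (fun m => expR (- (x j * G m))) 0%N))).
  apply: ler_wpM2l; first exact: ltW.
  apply: (@sum_prod_load_le R d d0 l (fun j m => expR (- (x j * G m))) (fun=> 0%N)).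
    by move=> j n; exact: expR_gt0.
  move=> j n; rewrite ler_expR lerN2 ler_wpM2l//.
  exact: (damped_mono dG).
rewrite mulrCA mulrC ler_wpM2r ?exprn_ge0//.
apply: (@le_trans _ _ (c * \prod_j expR (- (lam * (x j - x j ^+ 2 / 2))))).
  apply: ler_wpM2l; first exact: ltW.
  apply: ler_prod => j _; apply/andP; split.
    by apply/ltW/iter_throw_gt0 => // m; exact: expR_gt0.
  exact: damped_mgf.
rewrite -expR_sum -expRD ler_expR sumrN -mulr_sumr sumrB.
have -> : \sum_j x j = eps / nu ^+ 2.
  rewrite /x -mulr_suml -mulr_sumr -/V; field; by rewrite !gt_eqF.
have : \sum_j x j ^+ 2 / 2 <= eps ^+ 2 / (2 * nu ^+ 2).
  apply: (@le_trans _ _ (\sum_j eps ^+ 2 / (2 * nu ^+ 2 * V) * v j ^+ 2)).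
    apply: ler_sum => j _; rewrite /x.
    have -> : (eps * v j ^+ 2 / (nu ^+ 2 * V)) ^+ 2 / 2 =
       eps ^+ 2 / (2 * nu ^+ 2 * V) * v j ^+ 2 * (v j ^+ 2 / (nu ^+ 2 * V)).
      by field; rewrite !gt_eqF.
    rewrite ler_piMr ?ler_pdivrMr ?mul1r//.
    by rewrite mulr_ge0 ?sqr_ge0// divr_ge0 ?sqr_ge0// -mulrA mulr_ge0// ltW.
  rewrite -mulr_sumr -/V le_eqVlt; apply/orP; left; apply/eqP.
  by field; rewrite !gt_eqF.
have -> : - (eps ^+ 2 * l%:R / (2 * d%:R * nu ^+ 2)) =
    eps * (1 - eps) * lam / nu ^+ 2 - lam * (eps / nu ^+ 2 - eps ^+ 2 / (2 * nu ^+ 2)).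
  by rewrite /lam; field; rewrite !gt_eqF.
by rewrite lerD2l lerN2 => h; rewrite ler_wpM2l ?divr_ge0// lerD2l lerN2.
Qed.

End lower_tail.

(** * Two damped statistics *)

Section statistics.
Context {R : realType}.

(** Without the weight two the mean would fall below [l / d] as soon as rows can
select the same column. *)
Definition hits (m : nat) : R := if m is 0%N then 0 else 2.

(** The normalised maximum over [phi] of
[2 phi - (1 - U) phi^2 / m - U (phi - 1)^2 - x]. Its maximiser
[(1 + U) m / (1 + U (m - 1))] stays below [(1 + U) / U], whereas [U = x = 0]
would give the identity. *)
Definition saturated (U x : R) (m : nat) : R :=
  if m is 0%N then 0 else
  ((1 + U) ^+ 2 * m%:R / (1 + U * (m%:R - 1)) - U - x) / (1 + U ^+ 2 - x).

Lemma iter_throw_falling (l d : nat) (a b c : R) : 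
  iter l (throw d) (fun m => a * m%:R + b * (m%:R * (m%:R - 1))
     + c * (m%:R * (m%:R - 1) * (m%:R - 2))) 0%N =
  l%:R / d%:R * (a + b * ((l%:R - 1) / d%:R)
     + c * ((l%:R - 1) / d%:R) * ((l%:R - 2) / d%:R)).
Proof.
have -> : (fun m : nat => a * m%:R + b * (m%:R * (m%:R - 1))
     + c * (m%:R * (m%:R - 1) * (m%:R - 2))) =
  (fun m : nat => 1 * (a * m%:R + b * (m%:R * (m%:R - 1)))
     + c * (m%:R * (m%:R - 1) * (m%:R - 2))) by apply/funext => m; rewrite mul1r.
rewrite 2!iter_throw_lin iter_throw_falling1 iter_throw_falling2.
rewrite iter_throw_falling3; ring.
Qed.

Variables (l d : nat).
Hypothesis ld : (0 < l <= d)%N.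

Let l0 : (0 < l)%N. Proof. by case/andP: ld. Qed.
Let d0 : (0 < d)%N. Proof. by case/andP: ld => /leq_trans; apply. Qed.

Let y : R := (l%:R - 1) / d%:R.
Let lR : 1 <= l%:R :> R. Proof. by rewrite ler1n. Qed.
Let ldR : l%:R <= d%:R :> R. Proof. by rewrite ler_nat; case/andP: ld. Qed.
Let dR : 0 < d%:R :> R. Proof. by rewrite ltr0n. Qed.

Let y01 : 0 <= y <= 1.
Proof.
by rewrite divr_ge0 ?subr_ge0// ?ler0n//= ler_pdivrMr// mul1r; have := ldR; lra.
Qed.

Let y2 : y * ((l%:R - 2) / d%:R) <= y ^+ 2.
Proof.
have /andP[y0 _] := y01.
by rewrite expr2 ler_wpM2l// ler_pM2r ?invr_gt0//; lra.
Qed.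

(** The mean uses Bonferroni's inequality: the indicator of [0 < m] is at least
[m - m (m - 1) / 2]. *)
Lemma hits_damped : damped_load l d hits.
Proof.
split.
- by move=> [|m] [|n].
- move=> [|m] [|n]//= mn; first by rewrite ltxx.
  by rewrite ltr_nat => m2; rewrite ler_nat (leq_trans _ mn)// ltnW.
- apply: le_trans (@iter_throw_le _ d d0 l (fun m => 2 * m%:R
      + (-1) * (m%:R * (m%:R - 1)) + 0 * (m%:R * (m%:R - 1) * (m%:R - 2))) _ _ 0%N).
    rewrite iter_throw_falling -/y -[leLHS]mulr1 ler_wpM2l ?divr_ge0 ?ler0n//.
    by have /andP[] := y01; nra.
  move=> [|[|[|m]]] /=; rewrite ?mulr0n; try by lra.
  by rewrite -!natr1; have : 0 <= m%:R :> R := ler0n _ _; nra.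
Qed.

(** The crossing property holds because [saturated U x m - m] has the sign of a
concave quadratic in [m] that is nonnegative at [1]. For the mean, [1 / v] is
bounded below by its tangent at the mean load [y] of the other rows, and the
indicator of [0 < m] above by Bonferroni's third-order bound, so that only
factorial moments are needed. The bound [U <= 1 / 3] is sharp for this estimate
at [y = 1]. *)
Lemma saturated_damped (U x : R) : 0 <= U <= 1 / 3 -> 0 <= x <= U / 2 ->
  damped_load l d (saturated U x).
Proof.
move=> /andP[U0 U3] /andP[x0 xU].
have K0 : 0 < 1 + U ^+ 2 - x by nra.
have q0 (m : nat) : 0 < 1 + U * (m.+1%:R - 1).
  by rewrite -natr1 addrK; have : 0 <= m%:R :> R := ler0n _ _; nra.
split.
- move=> [|m] [|n]// mn /=.
    rewrite divr_ge0 ?(ltW K0)// -addrA -opprD subr_ge0 ler_pdivlMr//.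
    rewrite -natr1 addrK; have : 0 <= n%:R :> R := ler0n _ _.
    move: (n%:R) => t t0; apply: (@le_trans _ _ (1 * (t + 1))); last first.
      by rewrite ler_wpM2r ?addr_ge0//; nra.
    by apply: ler_pM; nra.
  rewrite ler_pM2r ?invr_gt0// -!addrA lerD2r ler_pdivrMr// [leRHS]mulrAC ler_pdivlMr//.
  have : m.+1%:R <= n.+1%:R :> R by rewrite ler_nat.
  move: (m.+1%:R) (n.+1%:R) => a b ab; rewrite -subr_ge0.
  rewrite [leRHS](_ : _ = (1 + U) ^+ 2 * ((b - a) * (1 - U))); last by ring.
  by rewrite mulr_ge0 ?sqr_ge0// mulr_ge0 ?subr_ge0//; lra.
- move=> [|m] [|n]// mn /=; first by rewrite ltxx.
  rewrite ltr_pdivrMr// ler_pdivrMr// -!addrA -opprD ltrBlDr lerBlDr.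
  rewrite ltr_pdivrMr// ler_pdivrMr//.
  have := q0 m; have := q0 n.
  have : m.+1%:R <= n.+1%:R :> R by rewrite ler_nat.
  have : 1 <= m.+1%:R :> R by rewrite ler1n.
  move: (m.+1%:R) (n.+1%:R) => a b a1 ab qb qa qlt.
  pose q t := (1 + U) ^+ 2 * t - (t * (1 + (U ^+ 2 - x)) + (U + x)) * (1 + U * (t - 1)).
  have qa0 : q a < 0 by rewrite /q subr_lt0.
  rewrite -subr_le0 -/(q b) leNgt; apply/negP => qb0.
  have concave : q a * (b - 1) = q 1 * (b - a) + q b * (a - 1)
     + U * (1 + U ^+ 2 - x) * ((a - 1) * (b - a) * (b - 1)) by rewrite /q; ring.
  have q1 : q 1 = U by rewrite /q; ring.
  have b1 : 1 < b.
    rewrite lt_neqAle (le_trans a1 ab) andbT; apply/eqP => b1.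
    by move: qa0; rewrite (_ : a = 1) ?q1; lra.
  have : q a * (b - 1) < 0 by rewrite pmulr_llt0// subr_gt0.
  rewrite concave q1 => /lt_geF/negP; apply.
  have ba : 0 <= b - a by rewrite subr_ge0.
  have aB1 : 0 <= a - 1 by rewrite subr_ge0.
  have bB1 : 0 <= b - 1 by rewrite subr_ge0 ltW.
  apply: addr_ge0; first by apply: addr_ge0; apply: mulr_ge0 => //; exact: ltW.
  by apply: mulr_ge0; rewrite !mulr_ge0// ltW.
- have /andP[yge0 yle1] := y01.
  pose w := 1 + U * y; have w0 : 0 < w by rewrite /w; nra.
  pose a := ((1 + U) ^+ 2 * (w^-1 + U * y / w ^+ 2) - U - x) / (1 + U ^+ 2 - x).
  pose b := (U / 2 - (1 + U) ^+ 2 * U / w ^+ 2) / (1 + U ^+ 2 - x).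
  pose c := - (U / 6) / (1 + U ^+ 2 - x).
  apply: le_trans (@iter_throw_le _ d d0 l (fun m => a * m%:R
      + b * (m%:R * (m%:R - 1)) + c * (m%:R * (m%:R - 1) * (m%:R - 2))) _ _ 0%N).
    rewrite iter_throw_falling -/y -[leLHS]mulr1 ler_wpM2l ?divr_ge0 ?ler0n//.
    set z := _ / _; have zy : y * z <= y ^+ 2 by exact: y2.
    have -> : a + b * y + c * y * z =
       ((1 + U) ^+ 2 / w - U * (1 - y / 2 + y * z / 6) - x) / (1 + U ^+ 2 - x).
      by rewrite /a /b /c; field; rewrite !gt_eqF.
    rewrite ler_pdivlMr// mul1r.
    have : 1 + U ^+ 2 + U * (1 - y / 2 + y ^+ 2 / 6) <= (1 + U) ^+ 2 / w.
      rewrite ler_pdivlMr// /w -subr_ge0.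
      have -> : (1 + U) ^+ 2 - (1 + U ^+ 2 + U * (1 - y / 2 + y ^+ 2 / 6)) * (1 + U * y) =
        U * (1 - y / 2 - y ^+ 2 / 6 - U * (y - y ^+ 2 / 2 + y ^+ 3 / 6) - U ^+ 2 * y).
        by field.
      rewrite mulr_ge0//.
      have y3 : y - y ^+ 2 / 2 + y ^+ 3 / 6 <= 2 / 3 + (y - 1) / 2.
        rewrite -subr_ge0.
        have -> : 2 / 3 + (y - 1) / 2 - (y - y ^+ 2 / 2 + y ^+ 3 / 6) =
          (1 - y) * ((1 - y) ^+ 2 / 6) by field.
        by rewrite mulr_ge0 ?subr_ge0// divr_ge0// sqr_ge0.
      have : U * (y - y ^+ 2 / 2 + y ^+ 3 / 6) <= U * (1 / 6 + y / 2).
        by rewrite ler_wpM2l//; lra.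
      have : U * (1 / 6 + y / 2) <= 1 / 3 * (1 / 6 + y / 2).
        by rewrite ler_wpM2r//; lra.
      have : U ^+ 2 * y <= 1 / 9 * y by rewrite ler_wpM2r//; nra.
      have : y ^+ 2 <= y by rewrite expr2 ler_piMr.
      by lra.
    have : U * (y * z) <= U * y ^+ 2 by rewrite ler_wpM2l.
    by lra.
  move=> [|m] /=; first by lra.
  have := q0 m; have : 1 <= m.+1%:R :> R by rewrite ler1n.
  have : 0 <= (m.+1%:R - 1) * (m.+1%:R - 2) * (m.+1%:R - 3) :> R.
    case: m => [|[|m]]; rewrite ?subrr ?mulr0 ?mul0r//.
  move: (m.+1%:R) => M cubic M1; set v := 1 + _ => v0.
  have vw : v - w = U * (M - 1 - y) by rewrite /v /w; ring.
  rewrite ler_pdivlMr//.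
  have -> : (a * M + b * (M * (M - 1)) + c * (M * (M - 1) * (M - 2))) * (1 + U ^+ 2 - x) =
      (1 + U) ^+ 2 * M * (w^-1 - (v - w) / w ^+ 2)
      - U * (1 + (M - 1) * (M - 2) * (M - 3) / 6) - x * M.
    by rewrite vw /a /b /c; field; rewrite !gt_eqF.
  have tangent : w^-1 - (v - w) / w ^+ 2 <= v^-1.
    rewrite -subr_ge0.
    have -> : v^-1 - (w^-1 - (v - w) / w ^+ 2) = (v - w) ^+ 2 / (v * w ^+ 2).
      by field; rewrite !gt_eqF.
    by rewrite divr_ge0 ?sqr_ge0// mulr_ge0 ?sqr_ge0// ltW.
  have : (1 + U) ^+ 2 * M * (w^-1 - (v - w) / w ^+ 2) <= (1 + U) ^+ 2 * M / v.
    by rewrite ler_wpM2l// mulr_ge0 ?sqr_ge0//; lra.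
  have : 0 <= U * ((M - 1) * (M - 2) * (M - 3) / 6) by rewrite mulr_ge0// divr_ge0.
  have : 0 <= x * (M - 1) by rewrite mulr_ge0// subr_ge0.
  by lra.
Qed.

End statistics.

(** * Short steps force few draws *)

Section scalars.
Context {R : realType}.
Implicit Types a A b k E q n Y : R.

(** Consequences of an insufficient decrease for the squared length [q] of the step
and for [n], minus its product with the gradient. Here [a] is the inverse step
size, [A] a bound for [a], [b] a bound for the Hessian model, and [a * E / 2]
the required decrease of the model. The second alternative arises when
[A < a + b] and comes from the actual decrease. *)
Definition short_step a A b E q n : Prop :=
  (a + b <= A /\ q < E /\ 2 * n < a * E + b * q) \/
  (q < (1 - b / A) * E /\ 2 * n < a * ((1 - b / A) * E)).

(** Used with [Y] the part of the squared gradient carried by the drawn columns.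
The first upper bound on [Y] is decreasing in [q] for large [a] and the second
one is increasing; they are compared at [q = a E / (2 (a + b + k))]. *)
Lemma short_step_few_hits a A b k E q n Y :
  0 < a <= A -> 0 <= b < A -> 0 <= k -> b + k <= 2 * A -> 0 <= q -> 0 <= n ->
  short_step a A b E q n ->
  Y <= ((b + k) ^+ 2 - a ^+ 2) * q + 2 * a * n ->
  Y <= (a + b + k) ^+ 2 * q ->
  2 * Y < E * (A + b + k) ^+ 2.
Proof.
move=> /andP[a0 aA] /andP[b0 bA] k0 s2A q0 n0 short Y1 Y2.
pose s := b + k; have s0 : 0 <= s by rewrite addr_ge0.
have A0 : 0 < A by apply: lt_le_trans aA.
have bs : b <= s by rewrite lerDl.
rewrite -addrA -/s in Y2; rewrite -/s in Y1 s2A; rewrite -addrA -/s.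
have t0 : 0 < a + s by rewrite ltr_wpDr.
have key E' : 0 <= E' -> q < a * E' / (2 * (a + s)) ->
    2 * Y < E' * (A + s) ^+ 2.
  move=> E'0 qlt; apply: (@lt_le_trans _ _ ((a + s) * a * E')).
    have -> : (a + s) * a * E' = 2 * ((a + s) ^+ 2 * (a * E' / (2 * (a + s)))).
      by field; rewrite gt_eqF.
    by rewrite ltr_pM2l//; apply: le_lt_trans Y2 _; rewrite ltr_pM2l// exprn_gt0.
  by rewrite mulrC ler_wpM2l//; nra.
case: short => [[abA [qE nE]]|[qE nE]].
- have E0 : 0 < E by exact: le_lt_trans qE.
  have [qlt|qge] := ltP q (a * E / (2 * (a + s))); first exact: (key _ (ltW E0) qlt).
  have [sa|sa] := leP 0 (s ^+ 2 - a ^+ 2 + a * b).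
    have : Y < (s ^+ 2 + a * b) * E.
      have : (s ^+ 2 - a ^+ 2 + a * b) * q <= (s ^+ 2 - a ^+ 2 + a * b) * E.
        by rewrite ler_wpM2l// ltW.
      have : a * (2 * n) < a * (a * E + b * q) by rewrite ltr_pM2l.
      lra.
    move=> YE; suff : 2 * (s ^+ 2 + a * b) * E <= E * (A + s) ^+ 2 by lra.
    rewrite mulrC ler_pM2l//.
    have : 4 * (a * b) <= A ^+ 2.
      by have := sqr_ge0 (a - b); have : (a + b) ^+ 2 <= A ^+ 2; nra.
    nra.
  have : Y < (s ^+ 2 - a ^+ 2 + a * b) * (a * E / (2 * (a + s))) + a ^+ 2 * E.
    have : (s ^+ 2 - a ^+ 2 + a * b) * q <= (s ^+ 2 - a ^+ 2 + a * b) * (a * E / (2 * (a + s))).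
      by rewrite ler_wnM2l// ltW.
    have : a * (2 * n) < a * (a * E + b * q) by rewrite ltr_pM2l.
    lra.
  have -> : (s ^+ 2 - a ^+ 2 + a * b) * (a * E / (2 * (a + s))) + a ^+ 2 * E =
     (a * ((a + s) + a * b / (a + s)) / 2) * E.
    by field; rewrite gt_eqF.
  move=> YE; apply: lt_le_trans (_ : a * ((a + s) + a * b / (a + s)) * E <= _).
    by lra.
  rewrite mulrC ler_pM2l//.
  have : a * b / (a + s) <= b by rewrite ler_pdivrMr//; nra.
  nra.
- set E' := (1 - b / A) * E in qE nE.
  have E'0 : 0 < E' by exact: le_lt_trans qE.
  have E'E : E' <= E.
    have f1 : 0 < 1 - b / A by rewrite subr_gt0 ltr_pdivrMr// mul1r.
    have E0 : 0 < E by move: E'0; rewrite pmulr_rgt0.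
    by rewrite /E' ler_piMl ?(ltW E0)// gerBl divr_ge0// ltW.
  apply: (@lt_le_trans _ _ (E' * (A + s) ^+ 2)); last by rewrite ler_wpM2r ?sqr_ge0.
  have [qlt|qge] := ltP q (a * E' / (2 * (a + s))); first exact: (key _ (ltW E'0) qlt).
  have aN : a * (2 * n) < a * (a * E') by rewrite ltr_pM2l.
  have [sa|sa] := leP 0 (s ^+ 2 - a ^+ 2).
    have : (s ^+ 2 - a ^+ 2) * q <= (s ^+ 2 - a ^+ 2) * E' by rewrite ler_wpM2l// ltW.
    have : 2 * s ^+ 2 * E' <= (A + s) ^+ 2 * E' by rewrite ler_wpM2r ?(ltW E'0)//; nra.
    lra.
  have : (s ^+ 2 - a ^+ 2) * q <= (s ^+ 2 - a ^+ 2) * (a * E' / (2 * (a + s))).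
    by rewrite ler_wnM2l// ltW.
  have -> : (s ^+ 2 - a ^+ 2) * (a * E' / (2 * (a + s))) = (s - a) * a / 2 * E'.
    by field; rewrite gt_eqF.
  have : (a + s) * a * E' <= (A + s) ^+ 2 * E' by rewrite ler_wpM2r ?(ltW E'0)//; nra.
  lra.
Qed.

(** The left side collects the terms of [saturated_lt] that do not involve the
gradient. *)
Lemma short_step_remainder a A b k E q n r : r = A + b + k ->
  0 < a <= A -> 0 <= b < A -> 0 <= k -> 2 * A <= b + k -> 0 <= q -> 0 <= n ->
  short_step a A b E q n ->
  q * (k * r + r / A * (a + b) ^+ 2 + b * r / 2) + (2 * a + b) * n <
  E * (r ^+ 2 + A ^+ 2 - b * r / 2).
Proof.
move=> rE /andP[a0 aA] /andP[b0 bA] k0 s2A q0 n0 short.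
have A0 : 0 < A by apply: lt_le_trans aA.
have r3 : 3 * A <= r by lra.
have r0 : 0 < r by apply: lt_le_trans r3; lra.
have c0 : 0 <= k * r + r / A * (a + b) ^+ 2 + b * r / 2.
  have /ltW r0' := r0; have /ltW A0' := A0.
  apply: addr_ge0; last by rewrite divr_ge0// mulr_ge0.
  apply: addr_ge0; first exact: mulr_ge0.
  by apply: mulr_ge0; [exact: divr_ge0|exact: sqr_ge0].
have kE : k = r - A - b by rewrite rE; ring.
case: short => [[abA [qE nE]]|[qE nE]].
- have E0 : 0 < E by exact: le_lt_trans qE.
  have : (2 * a + b) * (2 * n) < (2 * a + b) * (a * E + b * E).
    by rewrite ltr_pM2l; nra.
  have : q * (k * r + r / A * (a + b) ^+ 2 + b * r / 2) <=
         E * (k * r + r / A * (a + b) ^+ 2 + b * r / 2) by rewrite ler_wpM2r// ltW.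
  have rA : r / A * (a + b) ^+ 2 <= r * A.
    by rewrite mulrAC ler_pdivrMr// -mulrA ler_pM2l//; nra.
  have : E * (k * r + r / A * (a + b) ^+ 2 + b * r / 2) <=
      E * (k * r + r * A + b * r / 2) by rewrite ler_pM2l// lerD2r lerD2l.
  have : (2 * a + b) * (a * E + b * E) <= 2 * A ^+ 2 * E.
    by rewrite -mulrDl mulrA ler_pM2r//; nra.
  by rewrite kE; lra.
- set E' := (1 - b / A) * E in qE nE.
  have bA1 : 0 < 1 - b / A by rewrite subr_gt0 ltr_pdivrMr// mul1r.
  have E'0 : 0 < E' by exact: le_lt_trans qE.
  have E0 : 0 < E by move: E'0; rewrite pmulr_rgt0.
  have : (2 * a + b) * (2 * n) < (2 * a + b) * (a * E') by rewrite ltr_pM2l; lra.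
  have : q * (k * r + r / A * (a + b) ^+ 2 + b * r / 2) <=
         E' * (k * r + r / A * (a + b) ^+ 2 + b * r / 2) by rewrite ler_wpM2r// ltW.
  have : E' * (r / A * (a + b) ^+ 2) <= E' * (r / A * (A + b) ^+ 2).
    by rewrite ler_pM2l// ler_pM2l ?divr_gt0//; nra.
  have : (2 * a + b) * (a * E') <= (2 * A + b) * (A * E').
    rewrite [leLHS]mulrA [leRHS]mulrA ler_pM2r//.
    have : a * a <= A * A by rewrite ler_pM// ltW.
    have : b * a <= b * A by rewrite ler_wpM2l.
    by lra.
  have : E' * (k * r + r / A * (A + b) ^+ 2 + b * r / 2 + (2 * A + b) * A / 2) <=
     E * (r ^+ 2 + A ^+ 2 - b * r / 2); last by lra.
  rewrite /E' mulrAC [leLHS]mulrC ler_pM2l// -subr_ge0 kE.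
  set be := b / A; set t := r / A.
  have bE : b = be * A by rewrite /be divfK// gt_eqF.
  have tE : r = t * A by rewrite /t divfK// gt_eqF.
  have be0 : 0 <= be by rewrite divr_ge0// ltW.
  have be1 : be <= 1 by move: bA1; rewrite -/be; lra.
  have t3 : 3 <= t by rewrite /t ler_pdivlMr.
  rewrite [leRHS](_ : _ = A ^+ 2 * (be * (t ^+ 2 - t * (2 - be / 2 - be ^+ 2)
     + (1 + be) / 2))); last by rewrite bE tE; field.
  by rewrite mulr_ge0 ?sqr_ge0// mulr_ge0//; nra.
Qed.

End scalars.

Lemma cauchy_schwarz (R : realType) (I : finType) (P : pred I) (x y : I -> R) :
  (\sum_(i | P i) x i * y i) ^+ 2 <=
  (\sum_(i | P i) x i ^+ 2) * (\sum_(i | P i) y i ^+ 2).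
Proof.
set C := \sum_(i | P i) x i * y i; set X := \sum_(i | P i) x i ^+ 2.
set Y := \sum_(i | P i) y i ^+ 2.
have X0 : 0 <= X by apply: sumr_ge0 => i _; exact: sqr_ge0.
have Y0 : 0 <= Y by apply: sumr_ge0 => i _; exact: sqr_ge0.
have : 0 <= \sum_(i | P i) (Y * x i - C * y i) ^+ 2.
  by apply: sumr_ge0 => i _; exact: sqr_ge0.
have -> : \sum_(i | P i) (Y * x i - C * y i) ^+ 2 = Y * (X * Y - C ^+ 2).
  rewrite (eq_bigr (fun i => Y ^+ 2 * x i ^+ 2 - 2 * Y * C * (x i * y i)
     + C ^+ 2 * y i ^+ 2)); last by move=> i _; ring.
  rewrite !big_split/= sumrN -!mulr_sumr -/X -/Y -/C; ring.
have [Ygt0|] := ltP 0 Y; first by rewrite pmulr_rge0// subr_ge0.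
move=> Yle0 _; have YE : Y = 0 by apply/eqP; rewrite eq_le Yle0 Y0.
have y0 i : P i -> y i = 0.
  move=> Pi; apply/eqP; rewrite -sqrf_eq0 eq_le sqr_ge0 andbT.
  rewrite -YE /Y (bigD1 i)//= lerDl; apply: sumr_ge0 => j _; exact: sqr_ge0.
by rewrite /C big1 ?expr0n ?mulr_ge0// => i Pi; rewrite y0// mulr0.
Qed.

(** If the tolerance [k] of the subproblem dominates, the residual is tested against
a vector with entries [phi (m_j) g_j]. Otherwise the residual is so small that
the part of the gradient carried by the drawn columns is enough. *)
Definition draw_statistic {R : realType} (A b k : R) : nat -> R :=
  if b + k <= 2 * A then hits
  else saturated (A / (A + b + k)) (b / (2 * (A + b + k))).

Section step.
Context {R : realType} {I : finType}.
Variables (m : I -> nat) (g y s : I -> R) (a A b k E : R).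
Hypothesis s_drawn : forall i, m i = 0%N -> s i = 0.
Hypothesis residual :
  \sum_i (m i)%:R * (g i + y i + a * s i) ^+ 2 <= k ^+ 2 * \sum_i s i ^+ 2.
Hypothesis y_le : \sum_i y i ^+ 2 <= b * \sum_i s i * y i.
Hypothesis sy0 : 0 <= \sum_i s i * y i.
Hypotheses (aA : 0 < a <= A) (bA : 0 <= b < A) (k0 : 0 <= k).

Let q := \sum_i s i ^+ 2.
Let n := - \sum_i g i * s i.
Hypothesis n0 : 0 <= n.
Hypothesis short : short_step a A b E q n.

Let P := fun i => (0 < m i)%N.
Let r := A + b + k.

Lemma sum_drawn (F : I -> R) : (forall i, F i = F i * (m i != 0%N)%:R) ->
  \sum_i F i = \sum_(i | P i) F i.
Proof.
move=> F0; rewrite [RHS]big_mkcond; apply: eq_bigr => i _.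
by rewrite /P lt0n; case: ifPn => // mi; rewrite F0 (negbTE mi) mulr0.
Qed.

Let a0 : 0 < a. Proof. by case/andP: aA. Qed.
Let b0 : 0 <= b. Proof. by case/andP: bA. Qed.
Let A0 : 0 < A. Proof. by case/andP: aA => ?; exact: lt_le_trans. Qed.
Let q0 : 0 <= q. Proof. by apply: sumr_ge0 => i _; exact: sqr_ge0. Qed.

Let s_m i : s i = s i * (m i != 0%N)%:R.
Proof. by have [mi|] := eqVneq (m i) 0%N; rewrite ?mulr1// s_drawn// mul0r. Qed.

Let qE : \sum_(i | P i) s i ^+ 2 = q.
Proof.
rewrite -sum_drawn// => i; rewrite s_m exprMn.
by case: (_ != _); rewrite ?expr1n ?mulr1 ?expr0n/= ?mulr0.
Qed.
Let nE : \sum_(i | P i) g i * s i = - n.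
Proof. by rewrite opprK -sum_drawn// => i; rewrite -mulrA -s_m. Qed.
Let p := \sum_i s i * y i.
Let pE : \sum_(i | P i) s i * y i = p.
Proof. by rewrite -sum_drawn// => i; rewrite mulrAC -s_m. Qed.
Let yy := \sum_(i | P i) y i ^+ 2.
Let yyp : yy <= b * p.
Proof.
apply: le_trans y_le; rewrite /yy big_mkcond; apply: ler_sum => i _.
by case: ifP => // _; exact: sqr_ge0.
Qed.
Let yy0 : 0 <= yy. Proof. by apply: sumr_ge0 => i _; exact: sqr_ge0. Qed.
Let p2 : p ^+ 2 <= q * yy.
Proof. by rewrite -pE -qE; exact: cauchy_schwarz. Qed.
Let yybq : yy <= b ^+ 2 * q.
Proof.
have [->|yyN0] := eqVneq yy 0; first by rewrite mulr_ge0 ?sqr_ge0.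
have yygt : 0 < yy by rewrite lt0r yyN0.
rewrite -(ler_pM2r yygt) -expr2 (@le_trans _ _ ((b * p) ^+ 2))//.
  by rewrite lerXn2r ?nnegrE ?mulr_ge0.
by rewrite exprMn -[leRHS]mulrA; apply: ler_wpM2l; rewrite ?sqr_ge0.
Qed.
Let pbq : p <= b * q.
Proof.
rewrite -(@ler_pXn2r _ 2) ?nnegrE ?mulr_ge0//; apply: le_trans p2 _.
by rewrite (_ : (b * q) ^+ 2 = q * (b ^+ 2 * q)); [apply: ler_wpM2l|ring].
Qed.

Let w i := a * s i + y i.
Let ww := \sum_(i | P i) w i ^+ 2.
Let wwE : ww = a ^+ 2 * q + 2 * a * p + yy.
Proof.
rewrite /ww /w (eq_bigr (fun i => a ^+ 2 * s i ^+ 2 + 2 * a * (s i * y i)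
   + y i ^+ 2)); last by move=> i _; ring.
by rewrite !big_split/= -!mulr_sumr qE pE.
Qed.
Let ww_le : ww <= (a + b) ^+ 2 * q.
Proof. rewrite wwE; have := ler_wpM2l (ltW a0) pbq; have := yybq; lra. Qed.

Let vv := \sum_(i | P i) (g i + w i) ^+ 2.
Let mvv := \sum_(i | P i) (m i)%:R * (g i + w i) ^+ 2.
Let mvv_le : mvv <= k ^+ 2 * q.
Proof.
apply: le_trans residual; rewrite /mvv [in leRHS]sum_drawn; last first.
  by move=> i; case: (m i) => [|mi]; rewrite ?mulr1// !mul0r.
by apply: ler_sum => i _; rewrite /w addrA addrAC.
Qed.

Let gg := \sum_(i | P i) g i ^+ 2.

Let vv_le : vv <= k ^+ 2 * q.
Proof.
apply: le_trans mvv_le; apply: ler_sum => i Pi.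
by rewrite ler_peMl ?sqr_ge0// ler1n.
Qed.

(** Triangle inequality for [g = (g + w) - w] on the drawn columns. *)
Let gg_le2 : gg <= (a + b + k) ^+ 2 * q.
Proof.
pose c := \sum_(i | P i) (g i + w i) * w i.
have -> : gg = vv - 2 * c + ww.
  rewrite /gg /vv /c /ww mulr_sumr -sumrB -big_split/=.
  by apply: eq_bigr => i _; ring.
have c2 : c ^+ 2 <= (k ^+ 2 * q) * ((a + b) ^+ 2 * q).
  apply: le_trans (cauchy_schwarz _ _ _) _.
  by rewrite ler_pM// ?sumr_ge0// => i _; exact: sqr_ge0.
have : - c <= k * (a + b) * q.
  have [c0|c0] := leP 0 c.
    by rewrite (@le_trans _ _ 0) ?oppr_le0// !mulr_ge0// addr_ge0// ltW.
  rewrite -(@ler_pXn2r _ 2) ?nnegrE ?oppr_ge0 ?(ltW c0)// ?mulr_ge0// ?addr_ge0// ?(ltW a0)//.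
  by rewrite sqrrN (le_trans c2)// le_eqVlt; apply/orP; left; apply/eqP; ring.
by have := vv_le; have := ww_le; lra.
Qed.

(** The same expansion, except that the multiple [a * s] of the step inside [w]
is paired with [g] exactly, through [n]. *)
Let gg_le1 : gg <= ((b + k) ^+ 2 - a ^+ 2) * q + 2 * a * n.
Proof.
pose c := \sum_(i | P i) (g i + w i) * y i.
have -> : gg = vv - 2 * c + 2 * a * n - a ^+ 2 * q + yy.
  have -> : 2 * a * n = - (2 * a) * \sum_(i | P i) g i * s i by rewrite nE; ring.
  rewrite -qE /gg /vv /c /yy !mulr_sumr -sumrN -big_split/= -big_split/=.
  by rewrite -sumrB -big_split/=; apply: eq_bigr => i _; rewrite /w; ring.
have c2 : c ^+ 2 <= (k ^+ 2 * q) * (b ^+ 2 * q).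
  apply: le_trans (cauchy_schwarz _ _ _) _.
  by rewrite ler_pM// ?sumr_ge0// => i _; exact: sqr_ge0.
have : - c <= k * b * q.
  have [c0|c0] := leP 0 c.
    by rewrite (@le_trans _ _ 0) ?oppr_le0// !mulr_ge0.
  rewrite -(@ler_pXn2r _ 2) ?nnegrE ?oppr_ge0 ?(ltW c0)// ?mulr_ge0//.
  by rewrite sqrrN (le_trans c2)// le_eqVlt; apply/orP; left; apply/eqP; ring.
by have := vv_le; have := yybq; lra.
Qed.

Lemma hits_lt : b + k <= 2 * A ->
  \sum_i hits (m i) * g i ^+ 2 < E * r ^+ 2.
Proof.
move=> s2A.
have -> : \sum_i hits (m i) * g i ^+ 2 = 2 * gg.
  rewrite sum_drawn; last by move=> i; case: (m i) => [|mi]; rewrite ?mul0r ?mulr1.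
  rewrite /gg mulr_sumr; apply: eq_bigr => i; rewrite /P.
  by case: (m i).
exact: (short_step_few_hits aA bA k0 s2A q0 n0 short gg_le1 gg_le2).
Qed.

(** With [c = phi i] and [v = g i + w i], the identity
[2 c g^2 = 2 c g v - 2 (c - 1) g w - 2 g z - (2 a + b) g s] splits the statistic
into products bounded by Young's inequality against the residual, the step and
the gradient itself. *)
Lemma saturated_lt : 2 * A <= b + k ->
  \sum_i saturated (A / r) (b / (2 * r)) (m i) * g i ^+ 2 < E * r ^+ 2.
Proof.
move=> s2A; have r3 : 3 * A <= r by rewrite /r; lra.
have r0 : 0 < r by apply: lt_le_trans r3; rewrite mulr_gt0 ?A0.
have kgt0 : 0 < k by have /andP[_] := bA; have := A0; lra.
pose U := A / r; pose x := b / (2 * r).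
have U0 : 0 < U by rewrite divr_gt0.
have U3 : U <= 1 / 3 by rewrite ler_pdivrMr//; lra.
have x0 : 0 <= x by rewrite divr_ge0// mulr_ge0// ltW.
have x1 : x <= 1 / 2.
  by rewrite /x ler_pdivrMr ?mulr_gt0//; have /andP[_] := bA; have := A0; lra.
have K0 : 0 < 1 + U ^+ 2 - x by have := sqr_ge0 U; lra.
pose M i : R := (m i)%:R.
have M1 i : P i -> 1 <= M i by rewrite /P /M ler1n.
have v0 i : P i -> 0 < 1 + U * (M i - 1).
  by move=> Pi; rewrite ltr_pwDl// mulr_ge0 ?subr_ge0 ?M1// ltW.
pose phi i := (1 + U) * M i / (1 + U * (M i - 1)).
have rem := short_step_remainder (erefl r) aA bA k0 s2A q0 n0 short.
suff main : \sum_(i | P i) (1 + U ^+ 2 - x) * (saturated U x (m i) * g i ^+ 2) <=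
    q * (k * r + r / A * (a + b) ^+ 2 + b * r / 2) + (2 * a + b) * n.
  rewrite sum_drawn; last by move=> i; case: (m i) => [|mi]; rewrite ?mul0r ?mulr1.
  rewrite -(ltr_pM2l K0) mulr_sumr; apply: le_lt_trans main _.
  apply: lt_le_trans rem _; rewrite le_eqVlt; apply/orP; left; apply/eqP.
  by rewrite /U /x; field; rewrite gt_eqF.
(* [z] recentres [y] at half of the bound [b]: its norm is at most half of
   that bound, which is what keeps the constants of the statistic. *)
pose z i := y i - b / 2 * s i.
have zz : \sum_(i | P i) z i ^+ 2 <= b ^+ 2 / 4 * q.
  rewrite /z (eq_bigr (fun i => y i ^+ 2 - b * (s i * y i)
     + b ^+ 2 / 4 * s i ^+ 2)); last by move=> i _; field.
  rewrite !big_split/= sumrN -!mulr_sumr qE pE -/yy; have := yyp; lra.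
have z0 i : P i -> b = 0 -> z i = 0.
  move=> Pi b00; rewrite /z b00 mul0r mul0r subr0; apply/eqP.
  rewrite -sqrf_eq0 eq_le sqr_ge0 andbT; apply: (@le_trans _ _ yy).
    rewrite /yy (bigD1 i)//= lerDl; apply: sumr_ge0 => j _; exact: sqr_ge0.
  by apply: le_trans yyp _; rewrite b00 mul0r.
apply: (@le_trans _ _ (\sum_(i | P i)
   (r / k * ((m i)%:R * (g i + w i) ^+ 2) + r / A * w i ^+ 2
    + 2 * r / b * z i ^+ 2 - (2 * a + b) * (g i * s i)))).
  apply: ler_sum => i Pi; have M0 : 0 < M i by apply: lt_le_trans (M1 _ Pi).
  rewrite -/(M i); set v := g i + w i; set c := phi i.
  have young1 : 2 * c * g i * v <= k / r * c ^+ 2 / M i * g i ^+ 2 + r / k * (M i * v ^+ 2).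
    rewrite -subr_ge0 (_ : _ - _ = (k * c * g i - r * M i * v) ^+ 2 / (k * r * M i)).
      by rewrite divr_ge0 ?sqr_ge0// !mulr_ge0// ltW.
    by field; rewrite !gt_eqF.
  have young2 : - (2 * (c - 1) * g i * w i) <=
      A / r * (c - 1) ^+ 2 * g i ^+ 2 + r / A * w i ^+ 2.
    rewrite -subr_ge0 (_ : _ - _ = (A * (c - 1) * g i + r * w i) ^+ 2 / (A * r)).
      by rewrite divr_ge0 ?sqr_ge0// mulr_ge0// ltW.
    by field; rewrite !gt_eqF.
  have young3 : - (2 * g i * z i) <= x * g i ^+ 2 + 2 * r / b * z i ^+ 2.
    have [b00|bn0] := eqVneq b 0.
      rewrite z0// mulr0 oppr0 expr0n/= mulr0 addr0.
      by rewrite mulr_ge0 ?sqr_ge0.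
    have bgt0 : 0 < b by rewrite lt0r bn0.
    rewrite -subr_ge0 (_ : _ - _ = (b * g i + 2 * r * z i) ^+ 2 / (2 * b * r)).
      by rewrite divr_ge0 ?sqr_ge0// !mulr_ge0// ltW.
    by rewrite /x; field; rewrite !gt_eqF.
  have split2 : 2 * c * g i ^+ 2 =
     2 * c * g i * v - 2 * (c - 1) * g i * w i - 2 * g i * z i - (2 * a + b) * (g i * s i).
    by rewrite /v /w /z; field.
  have kr : k / r <= 1 - U.
    by rewrite /U ler_pdivrMr// mulrBl divfK ?gt_eqF// mul1r /r; have := b0; lra.
  have c2 : k / r * (c ^+ 2 / M i * g i ^+ 2) <= (1 - U) * (c ^+ 2 / M i * g i ^+ 2).
    by rewrite ler_wpM2r// mulr_ge0 ?sqr_ge0// divr_ge0 ?sqr_ge0// ltW.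
  have satE : (1 + U ^+ 2 - x) * (saturated U x (m i) * g i ^+ 2) =
     2 * c * g i ^+ 2 - (1 - U) * (c ^+ 2 / M i * g i ^+ 2)
     - U * (c - 1) ^+ 2 * g i ^+ 2 - x * g i ^+ 2.
    have := M0; have := v0 _ Pi; move: Pi; rewrite /c /phi /P /M.
    case: (m i) => [//|j] _ /=; move: (j.+1%:R) => N N1 N0.
    by field; rewrite !gt_eqF.
  rewrite satE -/U in young2 *; lra.
rewrite !big_split/= sumrN -!mulr_sumr nE -/ww -/mvv.
have e1 : r / k * mvv <= k * r * q.
  apply: (@le_trans _ _ (r / k * (k ^+ 2 * q))).
    by rewrite ler_wpM2l// divr_ge0// ltW.
  by rewrite le_eqVlt; apply/orP; left; apply/eqP; field; rewrite gt_eqF.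
have e2 : r / A * ww <= r / A * ((a + b) ^+ 2 * q).
  by rewrite ler_wpM2l// divr_ge0// ltW.
have e3 : 2 * r / b * (\sum_(i | P i) z i ^+ 2) <= b * r / 2 * q.
  have [->|bn0] := eqVneq b 0; first by rewrite invr0 mulr0 !mul0r.
  have bgt0 : 0 < b by rewrite lt0r bn0.
  apply: (@le_trans _ _ (2 * r / b * (b ^+ 2 / 4 * q))).
    by rewrite ler_wpM2l// divr_ge0 ?mulr_ge0// ltW.
  by rewrite le_eqVlt; apply/orP; left; apply/eqP; field; rewrite gt_eqF.
lra.
Qed.

Lemma draw_statistic_lt :
  \sum_i draw_statistic A b k (m i) * g i ^+ 2 < E * (A + b + k) ^+ 2.
Proof.
rewrite /draw_statistic; case: ifPn; first exact: hits_lt.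
by rewrite -ltNge => /ltW; exact: saturated_lt.
Qed.

End step.

(** * Euclidean geometry and gradients *)

Section euclidean.
Context {R : realType}.

Lemma dotvC n (u v : 'cV[R]_n) : dotv u v = dotv v u.
Proof. by apply: eq_bigr => i _; rewrite mulrC. Qed.

Lemma dotvDl n (u v w : 'cV[R]_n) : dotv (u + v) w = dotv u w + dotv v w.
Proof. by rewrite /dotv -big_split/=; apply: eq_bigr => i _; rewrite mxE mulrDl. Qed.

Lemma dotvZl n a (u w : 'cV[R]_n) : dotv (a *: u) w = a * dotv u w.
Proof. by rewrite /dotv mulr_sumr; apply: eq_bigr => i _; rewrite mxE mulrA. Qed.

Lemma dotvDr n (u v w : 'cV[R]_n) : dotv w (u + v) = dotv w u + dotv w v.
Proof. by rewrite dotvC dotvDl !(dotvC w). Qed.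

Lemma dotvZr n a (u w : 'cV[R]_n) : dotv w (a *: u) = a * dotv w u.
Proof. by rewrite dotvC dotvZl (dotvC w). Qed.

Lemma dotv0 n (u : 'cV[R]_n) : dotv u 0 = 0.
Proof. by rewrite -[X in dotv u X](scale0r 0) dotvZr mul0r. Qed.

Lemma dotv_trmx m n (A : 'M[R]_(m, n)) u v : dotv (A *m u) v = dotv u (A^T *m v).
Proof.
rewrite /dotv; under eq_bigr do rewrite mxE mulr_suml.
rewrite exchange_big/=; apply: eq_bigr => j _; rewrite mxE mulr_sumr.
by apply: eq_bigr => i _; rewrite mxE mulrAC mulrC mulrA.
Qed.

Lemma dotv_ge0 n (u : 'cV[R]_n) : 0 <= dotv u u.
Proof. by apply: sumr_ge0 => i _; rewrite -expr2 sqr_ge0. Qed.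

Lemma sqr_l2norm n (u : 'cV[R]_n) : l2norm u ^+ 2 = dotv u u.
Proof. by rewrite sqr_sqrtr// dotv_ge0. Qed.

Lemma dotv_sumsq n (u : 'cV[R]_n) : dotv u u = \sum_i u i 0 ^+ 2.
Proof. by []. Qed.

Lemma dotv_le n (u v : 'cV[R]_n) : dotv u v <= l2norm u * l2norm v.
Proof.
have [uv|uv] := leP (dotv u v) 0; first by rewrite (le_trans uv)// mulr_ge0 ?sqrtr_ge0.
rewrite -(@ler_pXn2r _ 2) ?nnegrE ?mulr_ge0 ?sqrtr_ge0 ?(ltW uv)//.
by rewrite exprMn !sqr_l2norm !dotv_sumsq; exact: cauchy_schwarz.
Qed.

Lemma l2norm_mulmx_le n (B : 'M[R]_n) (v : 'cV[R]_n) :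
  l2norm (B *m v) <= opnorm2 B * l2norm v.
Proof.
have bounded : has_ubound [set l2norm (B *m v) | v in [set v : 'cV[R]_n | l2norm v <= 1]].
  exists (Num.sqrt (\sum_i \sum_j B i j ^+ 2)) => _ [w w1 <-].
  rewrite /l2norm ler_sqrt; last by apply: sumr_ge0 => i _; apply: sumr_ge0 => j _; exact: sqr_ge0.
  rewrite dotv_sumsq; apply: ler_sum => i _; rewrite mxE.
  apply: le_trans (cauchy_schwarz _ _ _) _; rewrite -dotv_sumsq -sqr_l2norm.
  rewrite ler_piMr//; first by apply: sumr_ge0 => j _; exact: sqr_ge0.
  by rewrite exprn_ile1// sqrtr_ge0.
have [v0|v0] := eqVneq (l2norm v) 0.
  have -> : v = 0.
    apply/matrixP => i j; rewrite ord1 mxE; apply/eqP; rewrite -sqrf_eq0 eq_le sqr_ge0 andbT.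
    rewrite -[leRHS](expr0n R 2)/= -v0 sqr_l2norm dotv_sumsq (bigD1 i)//= lerDl.
    by apply: sumr_ge0 => k _; exact: sqr_ge0.
  by rewrite mulmx0 /l2norm /dotv !big1 ?sqrtr0 ?mulr0// => i _; rewrite mxE mul0r.
have vgt0 : 0 < l2norm v by rewrite lt0r v0 sqrtr_ge0.
have l2normZ m c (u : 'cV[R]_m) : 0 <= c -> l2norm (c *: u) = c * l2norm u.
  by move=> c0; rewrite /l2norm dotvZl dotvZr mulrA sqrtrM ?mulr_ge0// -expr2 sqrtr_sqr ger0_norm.
rewrite -ler_pdivrMr// mulrC -l2normZ ?invr_ge0 ?(ltW vgt0)// scalemxAr.
apply: (ub_le_sup bounded); exists ((l2norm v)^-1 *: v) => //=.
by rewrite l2normZ ?invr_ge0 ?(ltW vgt0)// mulVf.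
Qed.

(** From the nonnegativity of the form at [v - B v / b]. *)
Lemma psd_sqr_le n (B : 'M[R]_n) (b : R) (v : 'cV[R]_n) :
  psdmx B -> opnorm2 B <= b -> 0 <= b ->
  dotv (B *m v) (B *m v) <= b * dotv v (B *m v).
Proof.
move=> [Bsym Bpsd] Bb b0; set u := B *m v.
have norm_le w : l2norm (B *m w) <= b * l2norm w.
  by apply: le_trans (l2norm_mulmx_le _ _) _; rewrite ler_wpM2r ?sqrtr_ge0.
have [b00|bN0] := eqVneq b 0.
  have : l2norm u <= 0 by apply: le_trans (norm_le v) _; rewrite b00 mul0r.
  rewrite b00 mul0r -sqr_l2norm => u0; have /eqP -> : l2norm u == 0.
    by rewrite eq_le u0 sqrtr_ge0.
  by rewrite expr0n.
have bgt0 : 0 < b by rewrite lt0r bN0.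
have := Bpsd (v + (- b^-1) *: u).
rewrite mulmxDr -scalemxAr -/u !(dotvDl, dotvDr, dotvZl, dotvZr).
have -> : dotv v (B *m u) = dotv u u by rewrite -[in LHS]Bsym -dotv_trmx.
have uBu : dotv u (B *m u) <= b * dotv u u.
  apply: le_trans (dotv_le _ _) _; rewrite -[in leRHS]sqr_l2norm expr2 mulrA [b * _]mulrC -mulrA.
  by rewrite ler_wpM2l ?sqrtr_ge0.
move=> h; rewrite -subr_ge0.
have : b^-1 * (dotv u (B *m u)) <= dotv u u by rewrite ler_pdivrMl.
move=> h2; have : b^-1 * (b^-1 * dotv u (B *m u)) <= b^-1 * dotv u u.
  by rewrite ler_wpM2l ?invr_ge0.
have : dotv v u - b^-1 * dotv u u = b^-1 * (b * dotv v u - dotv u u) by field.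
move=> h3 h4; have : 0 <= b^-1 * (b * dotv v u - dotv u u) by lra.
by rewrite pmulr_rge0 ?invr_gt0.
Qed.

Lemma derive_quadratic n (q : 'cV[R]_n -> R) (a v : 'cV[R]_n) (c1 c2 : R) :
  (forall h : R, q (h *: v + a) = q a + h * c1 + h ^+ 2 * c2) ->
  'D_v q a = c1.
Proof.
move=> qE; apply: cvg_lim => //.
apply: (@cvg_trans _ ((fun h : R => c1 + h * c2) @ 0^')).
  apply: near_eq_cvg; near=> h.
  have h0 : h != 0 by near: h; exact: nbhs_dnbhs_neq.
  by rewrite /= qE /GRing.scale/=; field.
have {2}-> : c1 = c1 + 0 * c2 by rewrite mul0r addr0.
apply: cvgD; first exact: cvg_cst.
apply: cvgM; last exact: cvg_cst.
exact: nbhs_dnbhs.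
Unshelve. all: by end_near. Qed.

Lemma derive_grad n (f : 'cV[R]_n -> R) (x v : 'cV[R]_n) :
  differentiable f x -> 'D_v f x = dotv (grad f x) v.
Proof.
move=> df; rewrite deriveE//.
have -> : v = \sum_i v i 0 *: delta_mx i 0.
  by rewrite {1}(matrix_sum_delta v); apply: eq_bigr => i _; rewrite big_ord1.
rewrite linear_sum/=; apply: eq_bigr => i _.
rewrite linearZ/= -deriveE// mxE mulrC; congr (_ * _).
rewrite summxE (bigD1 i)//= big1 ?addr0 ?mxE ?eqxx ?mulr1// => j ji.
by rewrite !mxE eq_sym (negbTE ji) mulr0.
Qed.

(** On the segment from [x] to [x + s] the difference of the two sides has a
nonpositive derivative, by the Lipschitz bound and Cauchy-Schwarz. *)
Lemma descent n (f : 'cV[R]_n -> R) (L : R) (x s : 'cV[R]_n) :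
  (forall x, differentiable f x) -> lipschitz_grad f L ->
  f (x + s) <= f x + dotv (grad f x) s + L / 2 * dotv s s.
Proof.
move=> df fL; set g := dotv (grad f x) s.
pose psi (t : R) := f (x + t *: s) - (t * g + L / 2 * dotv s s * t ^+ 2).
suff : psi 1 <= psi 0.
  by rewrite /psi scale1r scale0r addr0; lra.
apply: (@derive_le0_le _ psi (fun t => dotv (grad f (x + t *: s)) s -
    (g + L * dotv s s * t))) => // [t|t /andP[t0 _]].
  have : is_derive t 1 (fun t => f (x + t *: s)) (dotv (grad f (x + t *: s)) s).
    rewrite -derive_grad//.
    have E : (fun h : R => h^-1 *: (((fun t => f (x + t *: s)) \o shift t) (h *: 1)
                - f (x + t *: s))) =
             (fun h => h^-1 *: ((f \o shift (x + t *: s)) (h *: s) - f (x + t *: s))).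
      apply/funext => h /=; congr (_ *: (f _ - _)).
      by rewrite (_ : h *: (1 : R) = h) ?scalerDl 1?addrCA//; exact: mulr1.
    have dv : derivable f (x + t *: s) s by exact: diff_derivable.
    by split; [rewrite /derivable E; exact: dv | rewrite /derive E].
  move=> h; rewrite /psi; apply: is_derive_eq.
  by rewrite !scaler1 /GRing.scale/=; field.
have := fL (x + t *: s) x.
have -> : x + t *: s - x = t *: s by rewrite addrC addKr.
have -> : l2norm (t *: s) = t * l2norm s.
  by rewrite /l2norm dotvZl dotvZr mulrA sqrtrM ?mulr_ge0// -expr2 sqrtr_sqr ger0_norm.
move=> Lip; have := dotv_le (grad f (x + t *: s) - grad f x) s.
rewrite dotvDl -scaleN1r dotvZl -/g scaleN1r => h.
have : l2norm (grad f (x + t *: s) - grad f x) * l2norm s <= L * (t * l2norm s) * l2norm s.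
  by rewrite ler_wpM2r ?sqrtr_ge0.
rewrite -(sqr_l2norm s); lra.
Qed.

End euclidean.

(** * Decrease in one iteration *)

Definition sampling_mx {R : realType} {l d : nat} (t : {ffun 'I_l -> 'I_d}) :
    'M[R]_(l, d) :=
  \matrix_(i, j) (if j == t i then Num.sqrt (d%:R / l%:R) else 0).

Section sampling.
Context {R : realType} {l d : nat}.
Variable t : {ffun 'I_l -> 'I_d}.
Local Notation S := (@sampling_mx R l d t).
Local Notation rho := (Num.sqrt (d%:R / l%:R : R)).

Lemma sampling_mxE (v : 'cV[R]_d) i : (S *m v) i 0 = rho * v (t i) 0.
Proof.
rewrite mxE (bigD1 (t i))//= mxE eqxx big1 ?addr0// => j jt.
by rewrite mxE (negbTE jt) mul0r.
Qed.

Lemma sum_draws (F : 'I_d -> R) : \sum_i F (t i) = \sum_j (load t j)%:R * F j.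
Proof.
under [RHS]eq_bigr do rewrite /load natr_sum mulr_suml.
rewrite exchange_big/=; apply: eq_bigr => i _.
rewrite (bigD1 (t i))//= eqxx mul1r big1 ?addr0// => j.
by rewrite eq_sym => /negbTE ->; rewrite mul0r.
Qed.

Lemma dotv_sampling (v : 'cV[R]_d) :
  dotv (S *m v) (S *m v) = d%:R / l%:R * \sum_j (load t j)%:R * v j 0 ^+ 2.
Proof.
rewrite -(sum_draws (fun j => v j 0 ^+ 2)) dotv_sumsq mulr_sumr.
by apply: eq_bigr => i _; rewrite sampling_mxE exprMn sqr_sqrtr.
Qed.

Lemma sampling_unloaded (u : 'cV[R]_l) j :
  load t j = 0%N -> (S^T *m u) j 0 = 0.
Proof.
move=> tj; rewrite mxE big1// => i _; rewrite !mxE.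
case: eqP => [jt|_]; last by rewrite mul0r.
by move: tj; rewrite /load (bigD1 i)//= jt eqxx.
Qed.

End sampling.

Section step.
Context {R : realType} {l d : nat}.
Variables (f : 'cV[R]_d -> R) (x : 'cV[R]_d) (S : 'M[R]_(l, d)) (B : 'M[R]_d).

Lemma modelE u :
  model f x S B u = f x + dotv (grad f x) (S^T *m u)
    + dotv (S^T *m u) (B *m (S^T *m u)) / 2.
Proof.
rewrite /model dotv_trmx; congr (_ + _ / 2).
by rewrite -!mulmxA -(trmxK S) -dotv_trmx trmxK.
Qed.

Lemma grad_reg_model (alpha : R) (u : 'cV[R]_l) : B^T = B ->
  grad (reg_model f x S B alpha) u =
  S *m (grad f x + B *m (S^T *m u) + alpha^-1 *: (S^T *m u)).
Proof.
move=> Bsym; apply/matrixP => i j; rewrite ord1 mxE.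
set e : 'cV[R]_l := delta_mx i 0.
have dote w : dotv w e = w i 0.
  rewrite /dotv (bigD1 i)//= big1 ?addr0 ?mxE ?eqxx ?mulr1// => k ki.
  by rewrite mxE (negbTE ki) mulr0.
rewrite -dote dotv_trmx !dotvDl dotvZl.
set se := S^T *m e; set su := S^T *m u.
apply: (@derive_quadratic _ _ _ _ _ _ (dotv se (B *m se) / 2 + (2 * alpha)^-1 * dotv se se)).
move=> h; rewrite /reg_model !modelE !sqr_l2norm.
rewrite mulmxDr -!scalemxAr -/se -/su mulmxDr -!scalemxAr.
rewrite !(dotvDl, dotvDr, dotvZl, dotvZr).
have -> : dotv (B *m su) se = dotv su (B *m se) by rewrite dotv_trmx Bsym.
have -> : dotv se (B *m su) = dotv su (B *m se) by rewrite -[in LHS]Bsym -dotv_trmx dotvC.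
rewrite (dotvC se su) invfM; move: alpha^-1 => a; by field.
Qed.

End step.

Section decrease.
Context {R : realType} {l d : nat}.
Variables (f : 'cV[R]_d -> R) (x : 'cV[R]_d) (t : {ffun 'I_l -> 'I_d}).
Variables (B : 'M[R]_d) (u : 'cV[R]_l).
Variables (L b theta alpha A kappa : R).
Hypotheses (ld : (0 < l <= d)%N).
Hypotheses (df : forall x, differentiable f x) (fL : lipschitz_grad f L).
Hypotheses (Bpsd : psdmx B) (Bb : opnorm2 B <= b) (b0 : 0 <= b) (L0 : 0 <= L).
Hypotheses (theta01 : 0 < theta < 1) (alpha0 : 0 < alpha) (kappa0 : 0 <= kappa).
Local Notation S := (sampling_mx t).
Hypothesis stationary :
  l2norm (grad (reg_model f x S B alpha) u) <= kappa * l2norm (S^T *m u).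
Hypothesis reg_decrease :
  reg_model f x S B alpha u <= reg_model f x S B alpha 0.

Let s := S^T *m u.
Let q := dotv s s.
Let n := - dotv (grad f x) s.
Let p := dotv s (B *m s).
Let D := n - p / 2.
Let F := f x - f (x + s).

Lemma model_decreaseE : model f x S B 0 - model f x S B u = D.
Proof.
rewrite !modelE mulmx0 mulmx0 /D /n /p -/s.
by rewrite !dotv0 mul0r !addr0; ring.
Qed.

Lemma model_decrease_ge : alpha^-1 * q / 2 <= D.
Proof.
have := reg_decrease; rewrite /reg_model !sqr_l2norm mulmx0 -/s -/q dotv0.
have := model_decreaseE; rewrite invfM; lra.
Qed.

Let p0 : 0 <= p. Proof. by case: Bpsd => _; apply. Qed.
Let q0 : 0 <= q. Proof. exact: dotv_ge0. Qed.
Let F_ge : n - L / 2 * q <= F.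
Proof. by have := descent x s df fL; rewrite /n /F -/q; lra. Qed.
Let ai0 : 0 < alpha^-1. Proof. by rewrite invr_gt0. Qed.

(** The error [L q / 2] of the linear model is at most [L alpha] times the model
decrease, because the regularised model does not increase. *)
Lemma small_alpha_successful : L * alpha <= 1 - theta ->
  sufficient_decrease f theta x S B u.
Proof.
move=> La; rewrite /sufficient_decrease model_decreaseE -/s -/F.
have qD : q / 2 <= alpha * D.
  have := model_decrease_ge; rewrite -(ler_pM2l alpha0) => h.
  by rewrite (le_trans _ h)// le_eqVlt; apply/orP; left; apply/eqP; field; rewrite gt_eqF.
have D0 : 0 <= D.
  by apply: le_trans model_decrease_ge; rewrite divr_ge0// mulr_ge0// ltW.
have : L * (q / 2) <= L * (alpha * D) by rewrite ler_wpM2l.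
have : L * alpha * D <= (1 - theta) * D by rewrite ler_wpM2r.
have nD : n = D + p / 2 by rewrite /D; ring.
have := F_ge; have := p0; lra.
Qed.

Lemma successful_decrease_ge0 : sufficient_decrease f theta x S B u -> 0 <= F.
Proof.
rewrite /sufficient_decrease model_decreaseE -/s -/F; apply: le_trans.
apply: mulr_ge0; first by apply: ltW; case/andP: theta01.
by apply: le_trans model_decrease_ge; rewrite divr_ge0// mulr_ge0// ltW.
Qed.

Hypothesis AL : L + b <= (1 - theta) * A.
Hypothesis aA : alpha^-1 <= A.

Let bA : b < A.
Proof.
have A0 : 0 < A by exact: lt_le_trans aA.
by have /andP[th0 th1] := theta01; have := mulr_gt0 th0 A0; have := AL; have := L0; lra.
Qed.

Let A0 : 0 < A. Proof. exact: lt_le_trans aA. Qed.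

Let yle : dotv (B *m s) (B *m s) <= b * p. Proof. exact: psd_sqr_le. Qed.

Let pbq : p <= b * q.
Proof.
apply: le_trans (dotv_le _ _) _; rewrite /q -(sqr_l2norm s) expr2 mulrCA.
rewrite ler_wpM2l ?sqrtr_ge0//; apply: le_trans (l2norm_mulmx_le _ _) _.
by rewrite ler_wpM2r ?sqrtr_ge0.
Qed.

(** If [a + b <= A] it suffices that the model decrease is small. Otherwise [L] is
so small compared with [a] that the descent lemma bounds the actual decrease
below by [theta A / (A - b)] times [n]. *)
Lemma bad_step_short (E : R) : theta * D <= F -> F < theta * (alpha^-1 * E / 2) ->
  short_step alpha^-1 A b E q n.
Proof.
have /andP[th0 th1] := theta01.
move=> DF FE; have Dge := model_decrease_ge; set a := alpha^-1 in Dge FE *.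
have a0 : 0 < a := ai0; have aA' : a <= A := aA.
have nD : n = D + p / 2 by rewrite /D; ring.
have [abA|abA] := leP (a + b) A; [left|right].
  have DE : D < a * E / 2 by rewrite -(ltr_pM2l th0); exact: le_lt_trans FE.
  split=> //; split; last by have := pbq; lra.
  by rewrite -(ltr_pM2l a0); lra.
have Ab0 : 0 < A - b by rewrite subr_gt0.
have be : 1 - b / A = (A - b) / A by field; rewrite gt_eqF.
have qn : a * q <= 2 * n by have := p0; lra.
have : 2 * n < a * ((1 - b / A) * E).
  have X0 : 0 <= n - (A - b) / 2 * q.
    have : (A - b) * q <= a * q by rewrite ler_wpM2r//; lra.
    by lra.
  have thb : theta <= (A - b) / A.
    by rewrite ler_pdivlMr//; have := AL; have := L0; lra.
  have : theta * A / (A - b) * (n - (A - b) / 2 * q) <= n - (A - b) / 2 * q.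
    rewrite ler_piMl// ler_pdivrMr// mul1r.
    by move: thb; rewrite ler_pdivlMr.
  have -> : theta * A / (A - b) * (n - (A - b) / 2 * q) =
     theta * A / (A - b) * n - theta * A / 2 * q by field; rewrite gt_eqF.
  have : L * q <= ((1 - theta) * A - b) * q by rewrite ler_wpM2r//; have := AL; lra.
  have := F_ge => h1 h2 h3.
  have : theta * (A / (A - b) * n) < theta * (a * E / 2) by lra.
  rewrite (ltr_pM2l th0) => h4.
  have : (A - b) / A * (A / (A - b) * n) < (A - b) / A * (a * E / 2).
    by rewrite ltr_pM2l// divr_gt0.
  rewrite be (_ : (A - b) / A * (A / (A - b) * n) = n); first by lra.
  by field; rewrite !gt_eqF.
split=> //; rewrite -(ltr_pM2l a0); lra.
Qed.

(** [E] below is chosen so that the threshold of the statistic is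
[E (A + b + kappa / rho)^2], with [rho = sqrt (d / l)] the entry of [S]. *)
Lemma good_draw_decrease (eps : R) :
  let g := grad f x in
  l%:R / d%:R * (1 - eps) * dotv g g <=
    \sum_j draw_statistic A b (kappa / Num.sqrt (d%:R / l%:R)) (load t j) * g j 0 ^+ 2 ->
  sufficient_decrease f theta x S B u ->
  theta * (1 - eps) * dotv g g / (2 * alpha)
    * (Num.sqrt (d%:R / l%:R) * (b + A) + kappa) ^- 2 <= F.
Proof.
move=> g good; rewrite /sufficient_decrease model_decreaseE -/s -/F => DF.
rewrite leNgt; apply/negP => Fbad.
have lR : 0 < l%:R :> R by rewrite ltr0n; case/andP: ld.
have dR : 0 < d%:R :> R by rewrite ltr0n; case/andP: ld => ?; exact: leq_trans.
have rho2 : 0 < d%:R / l%:R :> R by rewrite divr_gt0.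
set rho := Num.sqrt (d%:R / l%:R) in good Fbad.
have rho0 : 0 < rho by rewrite sqrtr_gt0.
have rhoE : rho ^+ 2 = d%:R / l%:R by rewrite sqr_sqrtr// ltW.
set k := kappa / rho in good; have k0 : 0 <= k by rewrite divr_ge0// ltW.
have r0 : 0 < A + b + k by rewrite ltr_wpDr// ltr_wpDr.
pose E := l%:R / d%:R * (1 - eps) * dotv g g / (A + b + k) ^+ 2.
have short : short_step alpha^-1 A b E q n.
  apply: bad_step_short DF _; apply: lt_le_trans Fbad _.
  rewrite le_eqVlt; apply/orP; left; apply/eqP.
  have -> : rho * (b + A) + kappa = rho * (A + b + k) by rewrite /k; field; rewrite gt_eqF.
  by rewrite exprMn rhoE /E; field; rewrite !gt_eqF.
suff lt : \sum_j draw_statistic A b k (load t j) * g j 0 ^+ 2 < E * (A + b + k) ^+ 2.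
  by have := le_lt_trans good lt; rewrite /E divfK ?ltxx// gt_eqF// exprn_gt0.
apply: (@draw_statistic_lt R _ (load t) (fun j => g j 0)
  (fun j => (B *m s) j 0) (fun j => s j 0) alpha^-1 A b k E) => //.
- by move=> j tj; exact: sampling_unloaded.
- have := stationary; rewrite grad_reg_model; last by case: Bpsd.
  rewrite -(@ler_pXn2r _ 2) ?nnegrE ?mulr_ge0 ?sqrtr_ge0// exprMn !sqr_l2norm.
  rewrite dotv_sampling -/s -ler_pdivlMl// => h; apply: le_trans (le_trans _ h) _.
    by apply: ler_sum => j _; rewrite !mxE.
  rewrite -dotv_sumsq -/q /k le_eqVlt; apply/orP; left; apply/eqP.
  by rewrite expr_div_n rhoE; field; rewrite !gt_eqF.
- by rewrite ai0.
- by rewrite b0.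
- rewrite -[leRHS]/n; have nD : n = D + p / 2 by rewrite /D; ring.
  by have := model_decrease_ge; have := mulr_ge0 (ltW ai0) q0; have := p0; lra.
Qed.

End decrease.

(** * Counting successes and failures *)

Section stepsizes.
Context {R : realType}.
Variables (gamma alphamax : R) (c p tau N : nat).
Variables (alpha : nat -> R) (succ : nat -> bool).
Hypotheses (gamma01 : 0 < gamma < 1) (amax0 : 0 < alphamax) (c0 : (0 < c)%N).
Let alpha0 := alphamax * gamma ^+ p.
Hypothesis alphaE0 : alpha 0%N = alpha0.
Hypothesis alphaS : forall k, (k < N)%N -> alpha k.+1 =
  if succ k then Num.min alphamax (gamma ^- c * alpha k) else gamma * alpha k.
Hypothesis fail_large : forall k, (k < N)%N -> 0 < alpha k -> ~~ succ k ->
  alpha0 * gamma ^+ tau <= alpha k.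

Let g0 : 0 < gamma. Proof. by case/andP: gamma01. Qed.
Let g1 : gamma <= 1. Proof. by case/andP: gamma01 => _ /ltW. Qed.
Let alpha0_gt0 : 0 < alpha0. Proof. by rewrite mulr_gt0// exprn_gt0. Qed.

(** A failure multiplies by [gamma] a step size that is at least
[alpha0 * gamma ^+ tau]; a success sets it to [alphamax] or does not lower it. *)
Lemma stepsize_bounds k : (k <= N)%N ->
  alpha0 * gamma ^+ tau.+1 <= alpha k <= alphamax.
Proof.
have gX n : gamma ^+ n <= 1 by apply: exprn_ile1; rewrite ?g1// ltW// g0.
have g1V : 1 <= gamma ^- c by rewrite invf_ge1 ?exprn_gt0 ?g0.
have le0 n : alpha0 * gamma ^+ n <= alpha0 by rewrite ger_pMr ?alpha0_gt0.
have le1 : alpha0 <= alphamax by rewrite /alpha0 ger_pMr.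
have low : alpha0 * gamma ^+ tau.+1 <= alphamax by apply: le_trans le1.
elim: k => [_|k IH kN]; first by rewrite alphaE0 le0 le1.
have /andP[lo hi] := IH (ltnW kN).
have ak0 : 0 < alpha k by apply: lt_le_trans lo; rewrite mulr_gt0 ?alpha0_gt0// exprn_gt0// g0.
rewrite alphaS//; case: ifPn => [_|fk].
  rewrite ge_min lexx/= andbT le_min low/=.
  by apply: le_trans lo _; rewrite ler_peMl// ltW.
apply/andP; split.
  by rewrite exprS mulrCA ler_pM2l ?g0// fail_large.
by apply: le_trans hi; rewrite ger_pMl// g1.
Qed.

(** Compares exponents of [gamma]: a failure adds one, a success removes at most [c],
and the lower bound on the step size caps the total at [tau + 1]. *)
Lemma failures_le : (N <= c.+1 * (\sum_(k < N) succ k) + tau.+1)%N.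
Proof.
pose U k := (\sum_(i < k) ~~ succ i)%N; pose S k := (\sum_(i < k) succ i)%N.
have US k : (U k + S k)%N = k.
  rewrite /U /S -big_split/= (eq_bigr (fun=> 1%N)) ?sum1_card ?card_ord// => i _.
  by case: (succ i).
have up k : (k <= N)%N -> alpha k * gamma ^+ (c * S k) <= alpha0 * gamma ^+ U k.
  elim: k => [_|k IH kN]; first by rewrite alphaE0 /U /S !big_ord0 muln0.
  rewrite /S /U !big_ord_recr/= -/(S k) -/(U k) alphaS//.
  have := IH (ltnW kN); case: (succ k) => /= h.
    rewrite addn0; apply: le_trans h.
    apply: (@le_trans _ _ (gamma ^- c * alpha k * gamma ^+ (c * (S k + 1)))).
      by rewrite ler_wpM2r ?exprn_ge0 ?(ltW g0)// ge_min lexx orbT.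
    rewrite mulnDr muln1 exprD le_eqVlt; apply/orP; left; apply/eqP.
    by field; rewrite expf_neq0// gt_eqF// g0.
  by rewrite addn0 addn1 exprS -mulrA [leRHS]mulrCA ler_pM2l ?g0.
have /andP[lo _] := stepsize_bounds (leqnn N).
have : alpha0 * gamma ^+ (tau.+1 + c * S N) <= alpha0 * gamma ^+ U N.
  by apply: le_trans (up _ (leqnn N)); rewrite exprD mulrA ler_pM2r// exprn_gt0// g0.
rewrite ler_pM2l ?alpha0_gt0// => h; have : (U N <= tau.+1 + c * S N)%N.
  rewrite leqNgt; apply/negP => lt; move: h; apply/negP; rewrite -ltNge.
  by rewrite ltr_iXn2l ?g0//; case/andP: gamma01.
by have := US N; rewrite -/(S N); move: (U N) (S N); clear; lia.
Qed.

End stepsizes.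

(** Each of the counts [s] of successes and [g] of good draws excludes few
iterations, so [s + g - N] of them are both. The bound on [N] makes this exceed
[(phi 0 - fstar) / h] by [N / (c + 1)^2 - 1 / (c + 1)], and [N >= c + 1] since
[r <= c / (c + 1)^2] and [c <= tau]. *)
Lemma few_good_iterations (R : realType) (N c tau : nat) (succ good : nat -> bool)
    (phi : nat -> R) (h fstar q delta1 : R) :
  (0 < c <= tau)%N -> (N <= c.+1 * (\sum_(k < N) succ k) + tau.+1)%N ->
  0 < h -> 0 <= q <= 1 -> 0 < delta1 ->
  (forall k, (k < N)%N -> phi k.+1 <= phi k) ->
  (forall k, (k < N)%N -> succ k -> good k -> phi k.+1 <= phi k - h) ->
  fstar <= phi N ->
  let r := q * (1 - delta1) - 1 + c%:R / (c%:R + 1) ^+ 2 in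
  0 < r ->
  (phi 0%N - fstar) / h + tau%:R / (1 + c%:R) <= r * N%:R ->
  (\sum_(k < N) good k)%:R <= (1 - delta1) * q * N%:R.
Proof.
move=> /andP[c0 ctau] failures h0 /andP[q0 q1] d0 decr gdecr fN r r0 Nle.
have cR : 1 <= c%:R :> R by rewrite ler1n.
have ctauR : c%:R <= tau%:R :> R by rewrite ler_nat.
set C := c%:R + 1 : R; have C0 : 0 < C by rewrite /C; lra.
rewrite leNgt; apply/negP => many.
pose gs k := (succ k && good k)%N.
have decrease k : (k <= N)%N -> phi k <= phi 0%N - h * (\sum_(i < k) gs i)%:R.
  elim: k => [_|k IH kN]; first by rewrite big_ord0 mulr0 subr0.
  rewrite big_ord_recr/= natrD; have := IH (ltnW kN).
  have := decr _ kN; have := gdecr _ kN; rewrite /gs.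
  by case: (succ k); case: (good k) => //=; [move=> /(_ isT isT)|move=> _..]; lra.
have gscount : (\sum_(k < N) succ k + \sum_(k < N) good k <= \sum_(k < N) gs k + N)%N.
  have NE : (\sum_(k < N) 1 = N)%N by rewrite sum1_card card_ord.
  rewrite -[X in (_ <= _ + X)%N]NE -!big_split/=; apply: leq_sum => i _.
  by rewrite /gs; case: (succ i); case: (good i).
move: failures gscount many (decrease _ (leqnn N)).
move: (\sum_(k < N) succ k)%N (\sum_(k < N) good k)%N (\sum_(k < N) gs k)%N => s g m.
move=> + + gN mdec; rewrite -(ler_nat R) => sN; rewrite -(ler_nat R) => mN.
move: sN mN; rewrite !natrD natrM -!natr1 -/C => sN mN.
have mh : m%:R <= (phi 0%N - fstar) / h.
  by rewrite ler_pdivlMr// mulrC; lra.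
have cC : c%:R / (1 + c%:R) <= tau%:R / (1 + c%:R) :> R.
  by rewrite ler_pM2r// invr_gt0; lra.
have m0 : 0 <= (phi 0%N - fstar) / h by apply: le_trans mh.
have NC : C <= N%:R.
  have rle : r <= c%:R / C ^+ 2.
    have : q * (1 - delta1) <= 1 by nra.
    by rewrite /r -/C; lra.
  have : c%:R / C <= c%:R / C ^+ 2 * N%:R.
    apply: (@le_trans _ _ (r * N%:R)); last by rewrite ler_wpM2r.
    by apply: le_trans Nle; rewrite {1}/C [c%:R + 1]addrC; lra.
  rewrite mulrAC ler_pdivlMr ?exprn_gt0// expr2 mulrA divfK ?gt_eqF//.
  by rewrite ler_pM2l// ltr0n.
have sge : (N%:R - tau%:R - 1) / C <= s%:R.
  by rewrite ler_pdivrMr// /C; lra.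
have NCC : C^-1 <= N%:R / C ^+ 2.
  by rewrite ler_pdivlMr ?exprn_gt0// expr2 mulrA mulVf ?gt_eqF// mul1r.
have key : N%:R / C - N%:R * (c%:R / C ^+ 2) = N%:R / C ^+ 2.
  by rewrite /C; field; rewrite gt_eqF.
have e1 : (N%:R - tau%:R - 1) / C = N%:R / C - tau%:R / C - C^-1 by field; rewrite gt_eqF.
move: Nle; rewrite /r -/C [1 + c%:R]addrC -/C; lra.
Qed.

(** * Chernoff bound along a filtration *)

Section counting.
Context {R : realType} {disp : measure_display} {Omega : measurableType disp}.
Variable P : probability Omega R.

Let pr (A : set Omega) : R := fine (P A).

Lemma prE (A : set Omega) : measurable A -> P A = (pr A)%:E.
Proof. by move=> mA; rewrite fineK// fin_num_measure. Qed.

Lemma pr_split (A B : set Omega) : measurable A -> measurable B ->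
  pr A = pr (A `&` B) + pr (A `\` B).
Proof.
move=> mA mB; apply: EFin_inj; rewrite EFinD -!prE//; [|exact: measurableD|exact: measurableI].
by rewrite addeC -measureDI.
Qed.

Lemma pr_bigsetU (I : Type) (r : seq I) (A : I -> set Omega) :
  (forall i, measurable (A i)) ->
  pr (\big[setU/set0]_(i <- r) A i) <= \sum_(i <- r) pr (A i).
Proof.
move=> mA; rewrite -lee_fin -prE; last exact: bigsetU_measurable.
elim: r => [|i r IH]; first by rewrite !big_nil measure0.
rewrite !big_cons EFinD -prE//; apply: le_trans (leeD2l _ IH).
by apply: measureU2 => //; exact: bigsetU_measurable.
Qed.

Variables (N : nat) (bad : nat -> set Omega) (H : nat -> set (set Omega)) (q : R).
Hypothesis Hsigma : forall k, sigma_algebra [set: Omega] (H k).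
Hypothesis Hmeas : forall k, (k <= N)%N -> H k `<=` measurable.
Hypothesis Hmono : forall k, (k < N)%N -> H k `<=` H k.+1.
Hypothesis Hbad : forall k, (k < N)%N -> H k.+1 (bad k).
Hypothesis q01 : 0 <= q <= 1.
Hypothesis bad_le : forall k A, (k < N)%N -> H k A -> pr (A `&` bad k) <= (1 - q) * pr A.

Definition good_count (n : nat) (w : Omega) : nat :=
  \sum_(k < n) `[< ~ bad k w >].

Let C n j := [set w | good_count n w = j].

Let CS n j : C n.+1 j.+1 = (C n j.+1 `&` bad n) `|` (C n j `\` bad n).
Proof.
apply/seteqP; split => w; rewrite /C /= /good_count big_ord_recr/=.
  case: asboolP => /= [nb|/contrapT b]; last by rewrite addn0 => ->; left.
  by rewrite addn1 => -[->]; right.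
case: asboolP => /= [nb|/contrapT b] [[-> //]|[-> //]] _; by rewrite ?addn0 ?addn1.
Qed.

Let CS0 n : C n.+1 0%N = C n 0%N `&` bad n.
Proof.
apply/seteqP; split => w; rewrite /C /= /good_count big_ord_recr/=.
  by case: asboolP => /= [nb|/contrapT b]; rewrite ?addn1// addn0.
by case: asboolP => /= [nb|/contrapT b] [-> //].
Qed.

Let C_big n j : (n < j)%N -> C n j = set0.
Proof.
move=> nj; apply/seteqP; split => // w; rewrite /C /= => h; move: nj; rewrite -h.
apply/negP; rewrite -leqNgt; apply: (@leq_trans (\sum_(k < n) 1)%N).
  by apply: leq_sum => i _; case: (`[< _ >]).
by rewrite sum1_card card_ord.
Qed.

Let HE n : H n = @measurable _ (g_sigma_algebraType (H n)).
Proof. by rewrite [RHS]sigma_algebra_id. Qed.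
Let HI n A B : H n A -> H n B -> H n (A `&` B).
Proof. by rewrite HE; exact: measurableI. Qed.
Let HD n A B : H n A -> H n B -> H n (A `\` B).
Proof. by rewrite HE; exact: measurableD. Qed.
Let HU n A B : H n A -> H n B -> H n (A `|` B).
Proof. by rewrite HE; exact: measurableU. Qed.

Let HC n j : (n <= N)%N -> H n (C n j).
Proof.
elim: n j => [|n IH] j nN.
  have [h0 hC _] := Hsigma 0; case: j => [|j].
    suff -> : C 0%N 0%N = setT by rewrite -(setD0 setT); exact: hC.
    by apply/seteqP; split => w // _; rewrite /C /= /good_count big_ord0.
  suff -> : C 0%N j.+1 = set0 by [].
  by apply/seteqP; split => w //; rewrite /C /= /good_count big_ord0.
have IHn i := Hmono nN (IH i (ltnW nN)).
case: j => [|j]; first by rewrite CS0; apply: HI => //; exact: Hbad.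
by rewrite CS; apply: HU; [apply: HI|apply: HD] => //; exact: Hbad.
Qed.

Let M (t : R) n := \sum_(j < n.+1) expR (- (t * j%:R)) * pr (C n j).

Let M0 t : M t 0 <= 1.
Proof.
rewrite /M big_ord1 mulr0 oppr0 expR0 mul1r.
have mC : measurable (C 0%N 0%N) by apply: (Hmeas (leq0n N)); exact: HC.
by rewrite -lee_fin -prE// probability_le1.
Qed.

Let MS t n : 0 <= t -> (n < N)%N -> M t n.+1 <= (1 - q + q * expR (- t)) * M t n.
Proof.
move=> t0 nN; rewrite /M big_ord_recl/= CS0.
have mC j : measurable (C n j) by apply: (Hmeas (ltnW nN)); apply: HC (ltnW nN).
have mb : measurable (bad n) by apply: (Hmeas nN); exact: Hbad.
pose a j := pr (C n j `&` bad n).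
have aN : a n.+1 = 0 by rewrite /a C_big// set0I /pr measure0.
have -> : \sum_(i < n.+1) expR (- (t * (bump 0 i)%:R)) * pr (C n.+1 (bump 0 i)) =
  \sum_(i < n.+1) expR (- (t * i.+1%:R)) * a i.+1 +
  expR (- t) * \sum_(i < n.+1) expR (- (t * i%:R)) * (pr (C n i) - a i).
  rewrite mulr_sumr -big_split/=; apply: eq_bigr => i _.
  rewrite /bump leq0n add1n CS.
  have -> : pr ((C n i.+1 `&` bad n) `|` (C n i `\` bad n)) = a i.+1 + (pr (C n i) - a i).
    have -> : pr (C n i) - a i = pr (C n i `\` bad n).
      by rewrite (pr_split (mC i) mb) /a addrC addKr.
    have m1 : measurable (C n i.+1 `&` bad n) by exact: measurableI.
    have m2 : measurable (C n i `\` bad n) by exact: measurableD.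
    have m3 := measurableU _ _ m1 m2.
    apply: EFin_inj; rewrite EFinD -!prE// measureU//.
    by apply/seteqP; split => w // [[_ b] [_ nb]].
  rewrite -natr1 (_ : - (t * (i%:R + 1)) = - t + - (t * i%:R)); last by ring.
  by rewrite expRD; ring.
rewrite addrA.
have -> : expR (- (t * 0)) * pr (C n 0%N `&` bad n) +
   \sum_(i < n.+1) expR (- (t * i.+1%:R)) * a i.+1 = \sum_(i < n.+1) expR (- (t * i%:R)) * a i.
  transitivity (\sum_(i < n.+2) expR (- (t * i%:R)) * a i).
    by rewrite [RHS]big_ord_recl/=.
  by rewrite big_ord_recr/= aN mulr0 addr0.
rewrite mulr_sumr mulr_sumr -big_split/=; apply: ler_sum => i _.
have ale : a i <= (1 - q) * pr (C n i) by apply: bad_le => //; exact: HC (ltnW nN).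
have et : expR (- t) <= 1 by rewrite -expR0 ler_expR oppr_le0.
rewrite mulrCA -mulrDr [leRHS]mulrCA ler_wpM2l ?expR_ge0//.
have : (1 - expR (- t)) * a i <= (1 - expR (- t)) * ((1 - q) * pr (C n i)).
  by rewrite ler_wpM2l// subr_ge0.
by lra.
Qed.

Let MN t : 0 <= t -> forall n, (n <= N)%N ->
  M t n <= (1 - q + q * expR (- t)) ^+ n.
Proof.
move=> t0; have /andP[q0 q1] := q01.
elim=> [|n IH] nN; first exact: M0.
apply: le_trans (MS t0 nN) _; rewrite exprS ler_wpM2l// ?IH ?(ltnW nN)//.
by rewrite addr_ge0 ?subr_ge0// mulr_ge0// expR_ge0.
Qed.

(** The sums [M t n] are the generating function of the number of good steps among
the first [n]; each step multiplies it by at most [1 - q + q * expR (- t)]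
([MS]). The bound follows by taking [t = delta]. *)
Lemma good_count_tail (delta : R) : 0 <= delta ->
  let E := [set w | (good_count N w)%:R <= (1 - delta) * q * N%:R] in
  measurable E /\ pr E <= expR (- (delta ^+ 2 / 2 * q * N%:R)).
Proof.
move=> d0 E; have /andP[q0 q1] := q01.
pose thr := (1 - delta) * q * N%:R.
pose A (j : nat) := if j%:R <= thr then C N j else set0.
have mC j : measurable (C N j) by apply: (Hmeas (leqnn N)); exact: HC.
have mA j : measurable (A j) by rewrite /A; case: ifP.
have EE : E = \big[setU/set0]_(j < N.+1) A j.
  apply/seteqP; split => w; rewrite -bigcup_mkord.
    move=> Ew; exists (good_count N w); last by rewrite /A Ew.
    rewrite /= ltnS leqNgt; apply/negP => lt.
    by have := C_big lt; rewrite seteqP => -[/(_ w erefl)].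
  by move=> [j _]; rewrite /A /E /=; case: ifP => // jt ->.
split; first by rewrite EE; exact: bigsetU_measurable.
rewrite EE; apply: le_trans (pr_bigsetU _ _) _ => //.
apply: (@le_trans _ _ (expR (delta * thr) * M delta N)).
  rewrite /M mulr_sumr; apply: ler_sum => j _; rewrite /A.
  have p0 : 0 <= pr (C N j) by rewrite -lee_fin -prE.
  case: ifP => jt; last by rewrite /pr measure0 !mulr_ge0// expR_ge0.
  rewrite mulrA -expRD -[leLHS]mul1r ler_wpM2r// -[leLHS]expR0 ler_expR.
  by rewrite -mulrBr mulr_ge0// subr_ge0.
apply: (@le_trans _ _ (expR (delta * thr) * expR (- (q * (delta - delta ^+ 2 / 2))) ^+ N)).
  rewrite ler_wpM2l ?expR_ge0//; apply: le_trans (MN d0 (leqnn N)) _.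
  rewrite lerXn2r ?nnegrE ?expR_ge0//.
    by rewrite addr_ge0 ?subr_ge0// mulr_ge0// expR_ge0.
  apply: le_trans (expR_ge1Dx _).
  have := expRN_le d0 => h.
  have : q * expR (- delta) <= q * (1 - delta + delta ^+ 2 / 2) by rewrite ler_wpM2l.
  by lra.
rewrite -expRM_natr -expRD le_eqVlt; apply/orP; left; apply/eqP; congr expR.
by rewrite /thr; field.
Qed.

End counting.

(** * Measurability and independence of the draws *)

(** An open set of column vectors is the union of the boxes with rational centre and
radius [1 / (n + 1)] that it contains, so the entries alone determine
measurability. *)
Lemma measurable_preimage_open (R : realType) (disp : measure_display)
    (T : measurableType disp) (d : nat) (X : T -> 'cV[R]_d) (O : set 'cV[R]_d) :
  (forall i, measurable_fun [set: T] (fun w => X w i 0)) -> open O ->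
  measurable (X @^-1` O).
Proof.
move=> mX oO.
pose box (qn : 'cV[rat]_d * nat) : set 'cV[R]_d :=
  [set y | forall i, `|y i 0 - ratr (qn.1 i 0)| < qn.2.+1%:R^-1].
have -> : X @^-1` O = \bigcup_(qn in [set: 'cV[rat]_d * nat])
    (if `[< box qn `<=` O >] then X @^-1` (box qn) else set0).
  apply/seteqP; split => w; last first.
    by move=> [qn _]; case: asboolP => // bO bw; exact: bO.
  move=> Ow; have /nbhs_ballP[e /= e0 eO] : nbhs (X w) O by exact: open_nbhs_nbhs.
  have [n ne] : exists n, 2 * n.+1%:R^-1 < e.
    have e20 : 0 < e / 2 by rewrite divr_gt0.
    have [n _ /(_ n (leqnn n))/= ne] := near_infty_natSinv_lt (PosNum e20).
    by exists n; rewrite mulrC -ltr_pdivlMr.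
  have qex i : exists q : rat, `|X w i 0 - ratr q| < n.+1%:R^-1.
    have [q /itvP qi] : exists q : rat, ratr q \in `]X w i 0 - n.+1%:R^-1, X w i 0 + n.+1%:R^-1[.
      apply: rat_in_itvoo; have : 0 < n.+1%:R^-1 :> R by rewrite invr_gt0.
      by move=> n0; rewrite ltrBlDr -addrA ltrDl addr_gt0.
    by exists q; rewrite distrC ltr_distl !qi.
  exists (\col_i sval (cid (qex i)), n) => //.
  case: asboolP => [_|[]].
    by move=> i /=; rewrite mxE; exact: svalP (cid (qex i)).
  move=> y yb; apply: eO; split=> // i j; rewrite ord1 /ball/=.
  have := yb i; have := svalP (cid (qex i)); rewrite /= mxE.
  move: (sval _) => z h1 h2.
  rewrite (_ : X w i 0 - y i 0 = (X w i 0 - ratr z) - (y i 0 - ratr z)); last by ring.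
  apply: le_lt_trans (ler_normB _ _) _; apply: lt_trans ne.
  by rewrite mulr_natl mulr2n ltrD.
apply: countable_bigcupT_measurable => [|qn]; first exact: countableP.
case: ifP => // _.
have -> : X @^-1` (box qn) =
   \bigcap_(i in [set: 'I_d]) ((fun w => X w i 0) @^-1` [set z | `|z - ratr (qn.1 i 0)| < qn.2.+1%:R^-1]).
  by apply/seteqP; split => w /=; [move=> h i _; exact: h|move=> h i; exact: h].
apply: fin_bigcap_measurable => [|i _]; first exact: finite_finset.
rewrite -[X in measurable X]setTI; apply: mX => //.
rewrite (_ : [set z | _] = ball (ratr (qn.1 i 0) : R) (qn.2.+1%:R^-1)).
  exact: measurable_realfun.measurable_ball.
by apply/seteqP; split => z /=; rewrite /ball/= distrC.
Qed.

Section draws.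
Context {R : realType} {disp : measure_display} {Omega : measurableType disp}.
Variable P : probability Omega R.
Context {l d : nat}.
Hypothesis l0 : (0 < l)%N.
Hypothesis d0 : (0 < d)%N.

(** The selected indices can be read off the nonzero entries of [S], so the event
that they form a given map belongs to the sigma-algebra of [S]. *)
Lemma scaled_sampling_draw (S : Omega -> 'M[R]_(l, d)) : scaled_sampling P S ->
  exists t : Omega -> {ffun 'I_l -> 'I_d},
    [/\ forall w, S w = sampling_mx (t w),
        forall t0, <<s mx_events S >> (t @^-1` [set t0]) &
        forall t0, P (t @^-1` [set t0]) = (d%:R ^- l : R)%:E].
Proof.
move=> [J [Junif Jind SE]].
pose t w := [ffun i => J i w]; exists t.
have rho0 : 0 < Num.sqrt (d%:R / l%:R) :> R.
  by rewrite sqrtr_gt0 divr_gt0// ltr0n.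
have StE w : S w = sampling_mx (t w).
  by rewrite SE; apply/matrixP => i j; rewrite !mxE ffunE.
have tE t0 : t @^-1` [set t0] = \bigcap_(i in [set` [set: 'I_l]%SET]) (J i @^-1` [set t0 i]).
  apply/seteqP; split => w /=.
    by move=> <- i _; rewrite /= ffunE.
  by move=> h; apply/ffunP => i; rewrite ffunE; apply: h; rewrite /= inE.
split=> // t0; last first.
  rewrite tE Jind (eq_bigr (fun=> (d%:R^-1 : R)%:E)); last first.
    by move=> i _; have [_ ->] := Junif i (t0 i).
  by rewrite prodEFin; congr EFin; rewrite prodr_const/= cardsT card_ord exprVn.
have -> : t @^-1` [set t0] = \bigcap_(i in [set: 'I_l]) ((fun w => S w i (t0 i)) @^-1` [set~ 0]).
  apply/seteqP; split => w /=.
    by move=> <- i _; rewrite /= StE mxE eqxx; apply/eqP; rewrite gt_eqF.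
  move=> h; apply/ffunP => i; have := h i I; rewrite /= StE mxE.
  by case: eqP => // ->.
have Sev : sigma_algebra [set: Omega] <<s mx_events S >>.
  exact: smallest_sigma_algebra.
rewrite -[X in X _]/(@measurable _ (g_sigma_algebraType (mx_events S))).
apply: fin_bigcap_measurable => [|i _]; first exact: finite_finset.
apply: sub_gen_smallest; exists i => //; exists (t0 i) => //.
exists [set~ 0]; first exact: measurableC.
by rewrite setTI.
Qed.

(** Split according to the value of the draw: each value has probability [d ^- l]
and is independent of the past, which decides for which values the draw is
bad. *)
Lemma indep_bad_draw (S : Omega -> 'M[R]_(l, d)) (H : set (set Omega))
    (t : Omega -> {ffun 'I_l -> 'I_d}) (bad : {ffun 'I_l -> 'I_d} -> set Omega) (delta : R)
    (A : set Omega) :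
  random_mx S -> (forall t0, <<s mx_events S >> (t @^-1` [set t0])) ->
  (forall t0, P (t @^-1` [set t0]) = (d%:R ^- l : R)%:E) ->
  independent_classes P <<s mx_events S >> H ->
  sigma_algebra [set: Omega] H -> H `<=` measurable ->
  (forall t0, H (bad t0)) ->
  (forall w, #|[set t0 | `[< bad t0 w >]]%SET|%:R <= delta * d%:R ^+ l) ->
  H A ->
  fine (P (A `&` [set w | bad (t w) w])) <= delta * fine (P A).
Proof.
move=> mS mt Pt indep sH Hm Hbad few HA.
have dl0 : 0 < d%:R ^+ l :> R by rewrite exprn_gt0// ltr0n.
have Smeas t0 : measurable (t @^-1` [set t0]).
  have : <<s mx_events S >> `<=` measurable; last by apply; exact: mt.
  apply: smallest_sub; first exact: sigma_algebra_measurable.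
  by move=> B [i _] [j _] [C mC <-]; exact: mS.
have mA : measurable A by exact: Hm.
have mbad t0 : measurable (bad t0) by exact: Hm.
have mAb t0 : measurable (A `&` bad t0) by exact: measurableI.
have HAb t0 : H (A `&` bad t0).
  have HE : H = @measurable _ (g_sigma_algebraType H) by rewrite [RHS]sigma_algebra_id.
  by rewrite HE; apply: measurableI; rewrite -HE.
have eqU : A `&` [set w | bad (t w) w] =
    \big[setU/set0]_(t0 : {ffun 'I_l -> 'I_d}) (t @^-1` [set t0] `&` (A `&` bad t0)).
  rewrite -bigcup_seq; apply/seteqP; split => w /=.
    by move=> [Aw bw]; exists (t w) => //=; rewrite mem_index_enum.
  by move=> [t0 _ [/= tw [Aw bw]]]; rewrite tw.
have total : (\sum_t0 P (A `&` bad t0) <= (delta * d%:R ^+ l)%:E * P A)%E.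
  have -> : (\sum_t0 P (A `&` bad t0) =
      \int[P]_(w in A) (\sum_(t0 : {ffun 'I_l -> 'I_d}) (\1_(bad t0) w)%:E))%E.
    rewrite ge0_integral_sum//.
      by apply: eq_bigr => t0 _; rewrite integral_indic// setIC.
    move=> t0; apply/measurable_realfun.measurable_EFinP; exact: measurable_realfun.measurable_indic.
  rewrite -integral_cst//; apply: ge0_le_integral => //.
  - by move=> w _; apply: sume_ge0 => t0 _; rewrite lee_fin.
  - apply: emeasurable_sum => t0; apply/measurable_realfun.measurable_EFinP.
    exact: measurable_realfun.measurable_indic.
  - move=> w _; rewrite sumEFin lee_fin; apply: le_trans (few w).
    rewrite -sum1_card natr_sum [leRHS]big_mkcond/=; apply: ler_sum => t0 _.
    by rewrite inE indicE; case: asboolP => b; [rewrite mem_set|rewrite memNset].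
rewrite eqU; apply: le_trans (pr_bigsetU _ _ _) _.
  by move=> t0; exact: measurableI.
have -> : \sum_t0 fine (P (t @^-1` [set t0] `&` (A `&` bad t0))) =
    d%:R ^- l * \sum_t0 fine (P (A `&` bad t0)).
  rewrite mulr_sumr; apply: eq_bigr => t0 _.
  by rewrite indep// Pt fineM// fin_num_measure.
rewrite ler_pdivrMl// mulrA [_ * delta]mulrC.
rewrite -lee_fin EFinM -(prE P mA) -sumEFin.
by under eq_bigr do rewrite -(prE P (mAb _)).
Qed.

End draws.

(** * Gradients of bounded nonuniformity *)

Lemma draw_statistic_damped (R : realType) (l d : nat) (A b k : R) :
  (0 < l <= d)%N -> 0 < A -> 0 <= b <= A -> 0 <= k -> damped_load l d (draw_statistic A b k).
Proof.
move=> ld A0 /andP[b0 bA] k0; rewrite /draw_statistic; case: ifPn => [_|].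
  exact: hits_damped.
rewrite -ltNge => s2A; have r0 : 0 < A + b + k by lra.
apply: saturated_damped => //; apply/andP; split.
- by apply: divr_ge0; exact: ltW.
- by rewrite ler_pdivrMr//; lra.
- by apply: divr_ge0 => //; apply: mulr_ge0 => //; exact: ltW.
- rewrite ler_pdivrMr ?mulr_gt0//.
  rewrite (_ : A / (A + b + k) / 2 * (2 * (A + b + k)) = A)//.
  by field; rewrite gt_eqF.
Qed.

Lemma continuous_sum (R : realType) (T : topologicalType) (I : Type) (r : seq I)
    (F : I -> T -> R) :
  (forall i, continuous (F i)) -> continuous (fun y => \sum_(i <- r) F i y).
Proof.
move=> cF; elim: r => [|i r IH] y.
  by under eq_fun do rewrite big_nil; exact: cvg_cst.
by under eq_fun do rewrite big_cons; apply: cvgD; [exact: cF|exact: IH].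
Qed.

Section gradient.
Context {R : realType} {d : nat}.
Variable f : 'cV[R]_d -> R.

Lemma nonuniformity_entry (nu : R) : is_nonuniformity f nu ->
  0 < nu /\ forall x i, grad f x i 0 ^+ 2 <= nu ^+ 2 * dotv (grad f x) (grad f x).
Proof.
have normP (y : 'cV[R]_d) i : `|y i 0| <= `|y|.
  by rewrite [leRHS]mx_normrE; apply: (le_bigmax _ (fun ij : 'I_d * 'I_1 => `|y ij.1 ij.2|) (i, ord0)).
have pos (y : 'cV[R]_d) : y != 0 -> 0 < l2norm y.
  move=> y0; rewrite sqrtr_gt0 lt0r dotv_ge0 andbT; apply: contra y0 => /eqP yy.
  apply/eqP/matrixP => i j; rewrite ord1 mxE; apply/eqP; rewrite -sqrf_eq0 eq_le sqr_ge0 andbT.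
  rewrite -yy dotv_sumsq (bigD1 i)//= lerDl; apply: sumr_ge0 => k _; exact: sqr_ge0.
move=> [[y [[x _ yx] /= /eqP y0] yn] ub].
have nu0 : 0 < nu by rewrite -yn divr_gt0 ?normr_gt0// pos.
split=> // z i; have [gz|gz] := eqVneq (grad f z) 0.
  by rewrite gz mxE expr0n/= dotv0 mulr0.
rewrite -sqr_l2norm -exprMn -ler_sqrt ?sqr_ge0// !sqrtr_sqr.
rewrite [leRHS]ger0_norm; last by rewrite mulr_ge0 ?(ltW nu0)// sqrtr_ge0.
apply: le_trans (normP _ _) _; rewrite -ler_pdivrMr ?pos//; apply: ub.
by exists (grad f z) => //; split; [exists z|apply/eqP].
Qed.

(** For [L <= 0] a gradient step from the minimiser shows that the gradient vanishes
there, hence everywhere, which leaves no direction to measure [nu]. *)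
Lemma lipschitz_gt0 (L nu fstar : R) : (forall x, differentiable f x) ->
  lipschitz_grad f L -> is_min (range f) fstar -> is_nonuniformity f nu -> 0 < L.
Proof.
move=> df fL [[xm _ fxm] fmin] [[y [[x _ yx] /= /eqP y0] _] _].
rewrite ltNge; apply/negP => L0.
have gxm : dotv (grad f xm) (grad f xm) <= 0.
  have := descent xm (- grad f xm) df fL.
  have : fstar <= f (xm - grad f xm) by apply: fmin; exists (xm - grad f xm).
  rewrite -scaleN1r !(dotvZl, dotvZr) => h1 h2.
  have : L / 2 * dotv (grad f xm) (grad f xm) <= 0.
    by rewrite mulr_le0_ge0 ?dotv_ge0//; lra.
  by rewrite -fxm in h1; lra.
have eq0 (z : 'cV[R]_d) : dotv z z <= 0 -> z = 0.
  move=> zz; apply/matrixP => i j; rewrite ord1 mxE; apply/eqP; rewrite -sqrf_eq0 eq_le sqr_ge0 andbT.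
  apply: le_trans zz; rewrite dotv_sumsq (bigD1 i)//= lerDl; apply: sumr_ge0 => k _; exact: sqr_ge0.
have := fL x xm; rewrite (eq0 _ gxm) subr0 yx => h.
have : l2norm y <= 0 by apply: le_trans h _; rewrite mulr_le0_ge0 ?sqrtr_ge0.
move=> ly; move/eqP: y0; apply; apply: eq0; rewrite -sqr_l2norm.
rewrite (_ : l2norm y = 0) ?expr0n//.
by apply/eqP; rewrite eq_le ly; exact: sqrtr_ge0.
Qed.

Lemma continuous_gradient_form (G : 'I_d -> R) : continuous (grad f) ->
  continuous (fun y => \sum_j G j * grad f y j 0 ^+ 2).
Proof.
move=> cg; apply: continuous_sum => j y.
have cj : (fun y => grad f y j 0) @ y --> grad f y j 0.
  apply: (@continuous_comp _ _ _ (grad f) (fun M : 'cV[R]_d => M j 0)).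
    exact: cg.
  exact: coord_continuous.
have Fy := nbhs_filter y.
under eq_fun do rewrite expr2.
exact: (cvgM (cvg_cst (G j)) (cvgM cj cj)).
Qed.

(** The set of points at which a given draw is bad has this form. *)
Lemma open_gradient_form_lt (G : 'I_d -> R) (c : R) : continuous (grad f) ->
  open [set y | \sum_j G j * grad f y j 0 ^+ 2 < c * dotv (grad f y) (grad f y)].
Proof.
move=> cg.
rewrite (_ : [set y | _] = (fun y => \sum_j (G j - c) * grad f y j 0 ^+ 2) @^-1` [set z | z < 0]).
  by apply: open_comp => [y _|]; [exact: continuous_gradient_form|exact: open_lt].
apply/funext => y /=; rewrite -[in LHS]subr_lt0 dotv_sumsq mulr_sumr -sumrB.
by under [in RHS]eq_bigr do rewrite mulrBl.
Qed.

Lemma open_gradient_gt (eps : R) : 0 < eps -> continuous (grad f) ->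
  open [set y | eps < l2norm (grad f y)].
Proof.
move=> eps0 cg.
rewrite (_ : [set y | _] = (fun y => \sum_j (-1) * grad f y j 0 ^+ 2) @^-1` [set z | z < - eps ^+ 2]).
  by apply: open_comp => [y _|]; [exact: continuous_gradient_form|exact: open_lt].
apply/funext => y /=; rewrite -mulr_sumr -dotv_sumsq mulN1r ltrN2 -sqr_l2norm.
by rewrite ltr_pXn2r ?nnegrE ?sqrtr_ge0 ?(ltW eps0).
Qed.

End gradient.

(** * Step size exponent and hitting time *)

(** The exponent is a natural number because [1 / gamma2 = gamma ^+ c] bounds the
argument of the logarithm. *)
Lemma tau_alphaP (R : realType) (gamma alpha0 alphalow : R) (c : nat) :
  0 < gamma < 1 -> 0 < alpha0 -> 0 < alphalow ->
  exists2 t : nat, tau_alpha gamma (gamma ^- c) alpha0 alphalow = t%:Z &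
    (c <= t)%N /\ alpha0 * gamma ^+ t <= alphalow.
Proof.
move=> /andP[g0 g1] a0 al0; rewrite /tau_alpha /log_base div1r invrK.
set z := Num.min _ _; have z0 : 0 < z by rewrite lt_min divr_gt0// exprn_gt0.
have lg : ln gamma < 0 by rewrite ln_lt0// g0.
have lgN : 0 < - ln gamma by rewrite oppr_gt0.
set t := Num.ceil _; have tge : ln z / ln gamma <= t%:~R by exact: ceil_ge.
have tlog : t%:~R * ln gamma <= ln z.
  by move: tge; rewrite -[_ / _]mulrNN -invrN ler_pdivrMr// mulrN lerN2.
have cz : c%:R <= ln z / ln gamma.
  rewrite -[_ / _]mulrNN -invrN ler_pdivlMr// mulrN lerN2.
  rewrite mulrC mulr_natr -lnXn// ler_ln ?posrE ?exprn_gt0//.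
  by rewrite ge_min lexx orbT.
have : c%:Z <= t by rewrite -(ler_int R); apply: le_trans tge.
move: tlog; case: t {tge} => // t tlog; rewrite lez_nat => ct.
exists t => //; split=> //.
rewrite mulrC -ler_pdivlMr//; apply: (@le_trans _ _ z); last by rewrite ge_min lexx.
by rewrite -ler_ln ?posrE ?exprn_gt0// lnXn// -mulr_natl.
Qed.

Lemma bigmin_leE (R : realType) (n : nat) (x e : R) (F : nat -> R) :
  \big[Num.min/x]_(k < n) F k <= e <-> x <= e \/ exists2 k, (k < n)%N & F k <= e.
Proof.
have seqE (r : seq 'I_n) : \big[Num.min/x]_(k <- r) F k <= e <->
    x <= e \/ exists2 k : 'I_n, k \in r & F k <= e.
  elim: r => [|i r IH].
    by rewrite big_nil; split=> [|[//|[]]]; [left|].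
  rewrite big_cons ge_min; split.
    move=> /orP[Fi|/IH[|[k kr Fk]]]; [|by left|].
      by right; exists i; rewrite ?mem_head.
    by right; exists k; rewrite ?in_cons ?kr ?orbT.
  move=> [xe|[k]]; first by apply/orP; right; apply/IH; left.
  rewrite in_cons => /orP[/eqP -> Fi|kr Fk]; apply/orP; [by left|right].
  by apply/IH; right; exists k.
split=> [/seqE[|[k _ Fk]]|h]; [by left|by right; exists k|apply/seqE].
by case: h => [|[k kn Fk]]; [left|right; exists (Ordinal kn); rewrite ?mem_index_enum].
Qed.

Lemma hitting_time_leE (R : realType) (d : nat) (f : 'cV[R]_d -> R)
    (disp : measure_display) (Omega : measurableType disp)
    (x : nat -> Omega -> 'cV[R]_d) (eps : R) (N : nat) w :
  (hitting_time f x eps w <= N%:R%:E)%E <->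
  exists2 k, (k <= N)%N & l2norm (grad f (x k w)) <= eps.
Proof.
split.
  move=> hN; have : (hitting_time f x eps w < N.+1%:R%:E)%E.
    by apply: le_lt_trans hN _; rewrite lte_fin ltr_nat.
  move=> /ereal_inf_lt[_ [M /= Mmin <-]]; rewrite lte_fin ltr_nat ltnS => MN.
  have [x0|[k kM xk]] := (bigmin_leE _ _ _ (fun k => l2norm (grad f (x k w)))).1 Mmin; first by exists 0%N.
  by exists k => //; apply: leq_trans MN.
move=> [k kN xk]; apply: ge_ereal_inf; exists k%:R%:E; last by rewrite lee_fin ler_nat.
exists k => //=; apply: (bigmin_leE _ _ _ (fun k => l2norm (grad f (x k w)))).2.
by right; exists k.
Qed.

(** * Good draws along a run *)

Section history.
Context {R : realType} {l d : nat}.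
Context {disp : measure_display} {Omega : measurableType disp}.
Variables (x : nat -> Omega -> 'cV[R]_d) (alpha : nat -> Omega -> R).
Variables (S : nat -> Omega -> 'M[R]_(l, d)) (B : nat -> Omega -> 'M[R]_d).
Variable (shat : nat -> Omega -> 'cV[R]_l).
Local Notation H := (history x alpha S B shat).

Lemma mx_events_measurable m n (X : Omega -> 'M[R]_(m, n)) :
  random_mx X -> mx_events X `<=` measurable.
Proof. by move=> mX A [i _] [j _] [C mC <-]; exact: mX. Qed.

Lemma history_measurable N k : (k <= N)%N ->
  (forall j, (j <= N)%N -> random_mx (x j) /\ measurable_fun [set: Omega] (alpha j)) ->
  (forall j, (j < N)%N -> [/\ random_mx (S j), random_mx (B j) & random_mx (shat j)]) ->
  H k `<=` measurable.
Proof.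
move=> kN mxa mSB; apply: smallest_sub; first exact: sigma_algebra_measurable.
move=> A [[j /= jk]|[j /= jk]].
  have [mx ma] : random_mx (x j) /\ measurable_fun [set: Omega] (alpha j).
    by apply: mxa; apply: leq_trans kN.
  by move=> [|[C mC <-]]; [exact: mx_events_measurable|exact: ma].
have [mS mB ms] : [/\ random_mx (S j), random_mx (B j) & random_mx (shat j)].
  by apply: mSB; apply: leq_trans kN.
by move=> [[]|]; exact: mx_events_measurable.
Qed.

Lemma history_mono k : H k `<=` H k.+1.
Proof.
apply: smallest_sub; first exact: smallest_sigma_algebra.
move=> A [[j /= jk] Aj|[j /= jk] Aj]; apply: sub_gen_smallest; [left|right]; exists j => //=.
  exact: ltnW.
exact: ltnW.
Qed.

Lemma history_iterate k (O : set 'cV[R]_d) : open O -> H k (x k @^-1` O).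
Proof.
move=> oO.
pose gen := (\bigcup_(j in `I_k.+1) (mx_events (x j) `|` rv_events (alpha j))) `|`
      (\bigcup_(j in `I_k)
         (mx_events (S j) `|` mx_events (B j) `|` mx_events (shat j))).
apply: (@measurable_preimage_open _ _ (g_sigma_algebraType gen) _ (x k)) => // i _ Y mY.
apply: sub_gen_smallest; left; exists k => /=; first exact: ltnSn.
by left; exists i => //; exists 0 => //; exists Y.
Qed.

Lemma history_draw k : <<s mx_events (S k) >> `<=` H k.+1.
Proof.
apply: smallest_sub; first exact: smallest_sigma_algebra.
move=> A Ak; apply: sub_gen_smallest; right; exists k => /=; first exact: ltnSn.
by left; left.
Qed.

End history.

Section run.
Context {R : realType} {l d : nat}.
Variables (f : 'cV[R]_d -> R) (nu : R).
Hypotheses (cg : continuous (grad f)) (nu0 : 0 < nu).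
Hypothesis nuP : forall x i, grad f x i 0 ^+ 2 <= nu ^+ 2 * dotv (grad f x) (grad f x).
Hypothesis ld : (0 < l <= d)%N.
Variables (G : nat -> R) (epsS : R).
Hypotheses (dG : damped_load l d G) (epsS0 : 0 <= epsS).
Context {disp : measure_display} {Omega : measurableType disp}.
Variable P : probability Omega R.
Variables (gamma1 gamma2 theta alphamax kappaT : R) (x0 : 'cV[R]_d) (alpha0 : R).
Variables (N : nat) (x : nat -> Omega -> 'cV[R]_d) (alpha : nat -> Omega -> R).
Variables (S : nat -> Omega -> 'M[R]_(l, d)) (B : nat -> Omega -> 'M[R]_d).
Variable (shat : nat -> Omega -> 'cV[R]_l).
Hypothesis run : quadratic_regularisation_run f P (scaled_sampling P)
    gamma1 gamma2 theta alphamax kappaT x0 alpha0 N x alpha S B shat.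

Definition bad_at (t : {ffun 'I_l -> 'I_d}) (y : 'cV[R]_d) : Prop :=
  \sum_j G (load t j) * grad f y j 0 ^+ 2 <
  l%:R / d%:R * (1 - epsS) * dotv (grad f y) (grad f y).

(** Where the gradient vanishes no draw is bad, both sides being zero. *)
Lemma few_bad_at y :
  #|[set t | `[< bad_at t y >]]%SET|%:R <= delta_sampling l d epsS nu * d%:R ^+ l.
Proof.
have /andP[l0 ld'] := ld; have d0 := leq_trans l0 ld'.
have [g0|gN0] := eqVneq (dotv (grad f y) (grad f y)) 0.
  rewrite (_ : #|_| = 0%N); first by rewrite mulr_ge0 ?exprn_ge0// expR_ge0.
  apply/eqP; rewrite cards_eq0; apply/eqP/setP => t; rewrite !inE.
  apply/negbTE/asboolPn; rewrite /bad_at g0 mulr0 => /lt_geF/negP; apply.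
  move: g0; rewrite dotv_sumsq => /eqP; rewrite psumr_eq0; last first.
    by move=> j _; exact: sqr_ge0.
  by move=> /allP g0; rewrite big1// => j _; rewrite (eqP (g0 j _)) ?mulr0// mem_index_enum.
have ggt : 0 < dotv (grad f y) (grad f y) by rewrite lt0r gN0 dotv_ge0.
rewrite (_ : [set t | _]%SET = [set t : {ffun 'I_l -> 'I_d} |
  \sum_j G (load t j) * grad f y j 0 ^+ 2 <
  l%:R / d%:R * (1 - epsS) * \sum_j grad f y j 0 ^+ 2]%SET); last first.
  by apply/setP => t; rewrite !inE asboolb.
exact: (few_bad_draws l0 d0 dG nu0 epsS0 ggt (nuP y)).
Qed.

Lemma open_bad_at t : open [set y | bad_at t y].
Proof. exact: (@open_gradient_form_lt _ _ f (fun j => G (load t j))). Qed.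

Lemma good_draws_tail (delta1 : R) : 0 <= delta1 ->
  exists (t : nat -> Omega -> {ffun 'I_l -> 'I_d}) (E : set Omega),
   [/\ forall k w, (k < N)%N -> S k w = sampling_mx (t k w),
     measurable E,
     (P E <= (expR (- (delta1 ^+ 2 / 2 * (1 - delta_sampling l d epsS nu) * N%:R)))%:E)%E &
     forall w, ~ E w -> (1 - delta1) * (1 - delta_sampling l d epsS nu) * N%:R <
       (\sum_(k < N) `[< ~ bad_at (t k w) (x k w) >])%:R].
Proof.
move=> d10; have /andP[l0 ld'] := ld; have d0 := leq_trans l0 ld'.
have [t tP] : exists t : nat -> Omega -> {ffun 'I_l -> 'I_d}, forall k, (k < N)%N ->
   [/\ forall w, S k w = sampling_mx (t k w),
      forall t0, <<s mx_events (S k) >> (t k @^-1` [set t0]) &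
      forall t0, P (t k @^-1` [set t0]) = (d%:R ^- l : R)%:E].
  have ex k : exists tk : Omega -> {ffun 'I_l -> 'I_d}, (k < N)%N ->
     [/\ forall w, S k w = sampling_mx (tk w),
        forall t0, <<s mx_events (S k) >> (tk @^-1` [set t0]) &
        forall t0, P (tk @^-1` [set t0]) = (d%:R ^- l : R)%:E].
    have [kN|_] := ltnP k N; last by exists (fun=> [ffun=> Ordinal d0]).
    by have [tk h] := scaled_sampling_draw l0 d0 (run_draw run kN); exists tk.
  by have [t tP] := choice ex; exists t.
pose H := history x alpha S B shat.
pose bad k := [set w | bad_at (t k w) (x k w)].
pose q := 1 - delta_sampling l d epsS nu.
have dS01 : 0 <= delta_sampling l d epsS nu <= 1.
  rewrite /delta_sampling expR_ge0 expR_le1 oppr_le0 /=.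
  by apply: divr_ge0; apply: mulr_ge0; rewrite ?sqr_ge0 ?mulr_ge0.
have q01 : 0 <= q <= 1.
  by case/andP: dS01 => ? ?; rewrite /q subr_ge0 gerBl; apply/andP; split.
have Hsigma k : sigma_algebra [set: Omega] (H k) by exact: smallest_sigma_algebra.
have Hmeas k : (k <= N)%N -> H k `<=` measurable.
  move=> kN; apply: (history_measurable kN); first exact: (run_measurable_iterates run).
  exact: (run_measurable_choices run).
have HX k t0 : H k ([set w | bad_at t0 (x k w)]).
  exact: (@history_iterate _ _ _ _ _ x alpha S B shat k _ (@open_bad_at t0)).
have Hbad k : (k < N)%N -> H k.+1 (bad k).
  move=> kN; have [_ mt _] := tP k kN.
  have -> : bad k = \big[setU/set0]_(t0 : {ffun 'I_l -> 'I_d})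
      (t k @^-1` [set t0] `&` [set w | bad_at t0 (x k w)]).
    rewrite -bigcup_seq; apply/seteqP; split => w /=.
      by move=> bw; exists (t k w) => //=; rewrite mem_index_enum.
    by move=> [t0 _ [/= tw bw]]; rewrite /bad /= tw.
  have HE : H k.+1 = @measurable _ (g_sigma_algebraType (H k.+1)).
    by rewrite [RHS]sigma_algebra_id.
  rewrite HE; apply: bigsetU_measurable => t0 _; apply: measurableI; rewrite -HE.
    by apply: history_draw; exact: mt.
  by apply: history_mono; exact: HX.
have bad_le k A : (k < N)%N -> H k A ->
    fine (P (A `&` bad k)) <= (1 - q) * fine (P A).
  move=> kN HA; have [SE mt Pt] := tP k kN.
  rewrite /q opprB addrC subrK.
  have [mS _ _] := run_measurable_choices run kN.
  exact: (indep_bad_draw d0 mS mt Pt (run_independent run kN) (Hsigma k)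
    (Hmeas k (ltnW kN)) (HX k) (fun w => few_bad_at (x k w)) HA).
have [mE PE] := good_count_tail Hsigma Hmeas (fun k _ => @history_mono _ _ _ _ _ x alpha S B shat k)
  Hbad q01 bad_le d10.
exists t; eexists; split; [by move=> k w kN; have [] := tP k kN|exact: mE| |].
  by rewrite -(@fineK _ (P _)) ?fin_num_measure// lee_fin.
by move=> w; rewrite /= => /negP; rewrite -ltNge.
Qed.

End run.

(** * Iteration complexity *)

Theorem theorem4p3 (R : realType) (d l : nat)
  (f : 'cV[R]_d -> R) (L fstar nu : R)
  (hf : continuously_differentiable f)
  (hL : lipschitz_grad f L)
  (hfstar : is_min (range f) fstar)
  (hnu : is_nonuniformity f nu)
  (hl : (0 < l <= d)%N)
  (c p : nat) (hc : (0 < c)%N) (hp : (0 < p)%N)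
  (gamma1 theta alphamax kappaT Bmax : R)
  (hgamma1 : 0 < gamma1 < 1) (htheta : 0 < theta < 1)
  (halphamax : 0 < alphamax) (hkappaT : 0 <= kappaT) (hBmax : 0 <= Bmax)
  (x0 : 'cV[R]_d)
  (delta1 epsS : R) (hdelta1 : 0 < delta1) (hepsS : 0 < epsS < 1) :
  let gamma2 := gamma1 ^- c in
  let alpha0 := alphamax * gamma1 ^+ p in
  let deltaS := delta_sampling l d epsS nu in
  let alphalow := (1 - theta) / (L + Bmax) in
  let tau := tau_alpha gamma1 gamma2 alpha0 alphalow in
  let h := decrease_bound l d theta epsS alphamax Bmax kappaT in
  deltaS < c%:R / (c%:R + 1) ^+ 2 ->
  0 < (rate c deltaS delta1)^-1 ->
  forall (disp : measure_display) (Omega : measurableType disp)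
    (P : probability Omega R) (N : nat)
    (x : nat -> Omega -> 'cV[R]_d) (alpha : nat -> Omega -> R)
    (S : nat -> Omega -> 'M[R]_(l, d)) (B : nat -> Omega -> 'M[R]_d)
    (shat : nat -> Omega -> 'cV[R]_l) (eps : R),
  quadratic_regularisation_run f P (scaled_sampling P)
    gamma1 gamma2 theta alphamax kappaT x0 alpha0 N x alpha S B shat ->
  (forall k w, (k < N)%N -> opnorm2 (B k w) <= Bmax) ->
  0 < eps ->
  (rate c deltaS delta1)^-1 *
    ((f x0 - fstar) / h eps (alpha0 * gamma1 ^ (c%:Z + tau)) +
     tau%:~R / (1 + c%:R)) <= N%:R ->
  ((1 - expR (- (delta1 ^+ 2 / 2 * (1 - deltaS) * N%:R)))%:E <=
   P [set w | hitting_time f x eps w <= N%:R%:E])%E.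
Proof.
move=> gamma2 alpha0 deltaS alphalow tau h dS rateV0 disp Omega P N x alpha S B shat eps run Bb eps0 HN.
have [df cg] := hf.
have L0 : 0 < L := lipschitz_gt0 df hL hfstar hnu.
have [nu0 nuP] := nonuniformity_entry hnu.
have [g0 g1] := andP hgamma1; have [th0 th1] := andP htheta; have [e0 e1] := andP hepsS.
have alpha0_gt0 : 0 < alpha0 by rewrite mulr_gt0// exprn_gt0.
have alphalow_gt0 : 0 < alphalow by rewrite divr_gt0 ?subr_gt0// ltr_pwDl.
have [tn tauE [ctn tn_low]] := tau_alphaP c hgamma1 alpha0_gt0 alphalow_gt0.
have {}tauE : tau = tn%:Z by exact: tauE.
pose amin := alpha0 * gamma1 ^+ (c + tn).
have amin_gt0 : 0 < amin by rewrite mulr_gt0// exprn_gt0.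
have aminE : alpha0 * gamma1 ^ (c%:Z + tau) = amin by rewrite tauE -PoszD -exprnP.
pose A := amin^-1; have A0 : 0 < A by rewrite invr_gt0.
pose rho : R := Num.sqrt (d%:R / l%:R).
have rho0 : 0 <= rho by exact: sqrtr_ge0.
have amin_low : amin <= alphalow.
  apply: le_trans tn_low; rewrite /amin ler_pM2l// exprD ger_pMl ?exprn_gt0//.
  by apply: exprn_ile1; apply: ltW.
have AL : L + Bmax <= (1 - theta) * A.
  have LB : 0 < L + Bmax by rewrite ltr_pwDl.
  by rewrite /A ler_pdivlMr// mulrC -ler_pdivlMr.
have BA : Bmax <= A.
  have : (1 - theta) * A <= A by rewrite ler_piMl ?(ltW A0)// gerBl ltW.
  by have := ltW L0; lra.
have k0 : 0 <= kappaT / rho by exact: divr_ge0.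
have dG : damped_load l d (draw_statistic A Bmax (kappaT / rho)).
  by apply: draw_statistic_damped; rewrite // hBmax.
have [t [E [SE mE PE goodE]]] := good_draws_tail cg nu0 nuP hl dG (ltW e0) run (ltW hdelta1).
have rate0 : 0 < rate c deltaS delta1 by move: rateV0; rewrite invr_gt0.
have dS01 : 0 <= deltaS <= 1.
  rewrite /deltaS /delta_sampling expR_ge0 expR_le1 oppr_le0 /=.
  by apply: divr_ge0; apply: mulr_ge0; rewrite ?sqr_ge0 ?mulr_ge0.
have hitE : [set w | (hitting_time f x eps w <= N%:R%:E)%E] =
    \big[setU/set0]_(k < N.+1) (x k @^-1` [set y | l2norm (grad f y) <= eps]).
  rewrite -(bigcup_mkord N.+1 (fun k => x k @^-1` [set y | l2norm (grad f y) <= eps])).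
  apply/seteqP; split => w /=.
    by move=> /hitting_time_leE[k kN xk]; exists k.
  by move=> [k /= kN xk]; apply/hitting_time_leE; exists k.
have mhit : measurable [set w | (hitting_time f x eps w <= N%:R%:E)%E].
  rewrite hitE; apply: bigsetU_measurable => k _.
  have [mx _] : random_mx (x k) /\ measurable_fun [set: Omega] (alpha k).
    by apply: (run_measurable_iterates run); rewrite -ltnS.
  rewrite (_ : x k @^-1` _ = ~` (x k @^-1` [set y | eps < l2norm (grad f y)])).
    apply: measurableC; apply: measurable_preimage_open; last exact: open_gradient_gt.
    by move=> i; exact: mx.
  by apply/funext => w; apply/propext => /=; rewrite leNgt; split=> /negP.
have stop w : ~ E w -> (hitting_time f x eps w <= N%:R%:E)%E.
  move=> nEw; apply: contrapT => nhit.
  have large k : (k <= N)%N -> eps < l2norm (grad f (x k w)).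
    move=> kN; rewrite ltNge; apply/negP => xk; apply: nhit.
    by apply/hitting_time_leE; exists k.
  pose succ k := sufficient_decrease f theta (x k w) (S k w) (B k w) (shat k w).
  pose good k := `[< ~ bad_at f (draw_statistic A Bmax (kappaT / rho)) epsS (t k w) (x k w) >].
  pose phi k := f (x k w).
  pose hh := h eps amin.
  have fail_large k : (k < N)%N -> 0 < alpha k w -> ~~ succ k ->
      alpha0 * gamma1 ^+ tn <= alpha k w.
    move=> kN ak0; apply: contraR; rewrite -ltNge => ak.
    rewrite /succ SE//; apply: (small_alpha_successful df hL (run_psd run w kN) (ltW L0) ak0).
      by rewrite -SE//; exact: (run_decrease run).
    have : alpha k w <= alphalow by apply: le_trans tn_low; exact: ltW.
    rewrite /alphalow ler_pdivlMr ?ltr_pwDl// mulrDr => h1.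
    by rewrite mulrC; apply: le_trans h1; rewrite lerDl mulr_ge0// ltW.
  have alphaS k : (k < N)%N -> alpha k.+1 w =
      if succ k then Num.min alphamax (gamma1 ^- c * alpha k w) else gamma1 * alpha k w.
    by move=> kN; exact: (run_next_alpha run).
  have bounds := stepsize_bounds hgamma1 halphamax (run_alpha0 run w) alphaS fail_large.
  have failures := failures_le hgamma1 halphamax (run_alpha0 run w) alphaS fail_large.
  have hh0 : 0 < hh.
    rewrite /hh /h /decrease_bound -/A mulr_gt0//.
      by rewrite divr_gt0 ?mulr_gt0 ?exprn_gt0// subr_gt0.
    rewrite invr_gt0 exprn_gt0// ltr_wpDr// mulr_gt0 ?ltr_wpDl//.
    by rewrite sqrtr_gt0 divr_gt0// ltr0n; case/andP: hl => // ? /(leq_trans _); apply.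
  have amin_le k : (k <= N)%N -> amin <= alpha k w.
    move=> kN; have /andP[lo _] := bounds k kN; apply: le_trans lo.
    rewrite ler_pM2l// ler_iXn2l ?(ltW g1)//.
    by rewrite -addn1 addnC leq_add2r.
  have ak0 k : (k <= N)%N -> 0 < alpha k w by move/amin_le; exact: lt_le_trans.
  have decr k : (k < N)%N -> phi k.+1 <= phi k.
    move=> kN; rewrite /phi (run_next_x run)//; case: ifPn => // sk.
    rewrite SE// in sk *; rewrite -subr_ge0.
    apply: successful_decrease_ge0 htheta (ak0 k (ltnW kN)) _ sk.
    by rewrite -SE//; exact: (run_decrease run).
  have gdecr k : (k < N)%N -> succ k -> good k -> phi k.+1 <= phi k - hh.
    move=> kN sk /asboolP; rewrite /bad_at => /negP; rewrite -leNgt => gk.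
    rewrite /phi (run_next_x run)// -/(succ k) sk lerBrDr -lerBrDl.
    rewrite /succ SE// in sk *.
    have stat : l2norm (grad (reg_model f (x k w) (sampling_mx (t k w)) (B k w) (alpha k w))
        (shat k w)) <= kappaT * l2norm ((sampling_mx (t k w))^T *m shat k w).
      by rewrite -SE//; exact: (run_stationary run).
    have rdec : reg_model f (x k w) (sampling_mx (t k w)) (B k w) (alpha k w) (shat k w)
        <= reg_model f (x k w) (sampling_mx (t k w)) (B k w) (alpha k w) 0.
      by rewrite -SE//; exact: (run_decrease run).
    have aA : (alpha k w)^-1 <= A by rewrite lef_pV2 ?posrE ?ak0 ?amin_le// ltnW.
    apply: le_trans (good_draw_decrease hl df hL (run_psd run w kN) (Bb k w kN) hBmax
      (ltW L0) htheta (ak0 k (ltnW kN)) hkappaT stat rdec AL aA gk sk).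
    rewrite /hh /h /decrease_bound -/A ler_wpM2r ?invr_ge0 ?sqr_ge0//.
    have /andP[_ hi] := bounds k (ltnW kN).
    have c0 : 0 <= theta * (1 - epsS) by apply: mulr_ge0; rewrite ?subr_ge0 ltW.
    apply: ler_pM.
    - by rewrite mulr_ge0// sqr_ge0.
    - by rewrite invr_ge0 mulr_ge0// ltW.
    - rewrite ler_wpM2l// -sqr_l2norm.
      by rewrite lerXn2r ?nnegrE ?sqrtr_ge0 ?(ltW eps0)// ltW// large// ltnW.
    - by rewrite lef_pV2 ?posrE ?mulr_gt0 ?ak0 ?(ltnW kN)// ler_pM2l.
  have few : (\sum_(k < N) good k)%:R <= (1 - delta1) * (1 - deltaS) * N%:R.
    have c_tn : (0 < c <= tn)%N by rewrite hc ctn.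
    have q01 : 0 <= 1 - deltaS <= 1.
      by case/andP: dS01 => ? ?; rewrite subr_ge0 gerBl; apply/andP.
    have fN : fstar <= phi N by apply: (hfstar.2); exists (x N w).
    apply: (few_good_iterations c_tn failures hh0 q01 hdelta1 decr gdecr fN rate0).
    rewrite -[leRHS]/(rate c deltaS delta1 * N%:R) -ler_pdivrMl//; apply: le_trans HN.
    by rewrite /hh -aminE /phi (run_x0 run) tauE.
  by have := le_lt_trans few (goodE w nEw); rewrite ltxx.
apply: (@le_trans _ _ (P (~` E))).
  by rewrite probability_setC// EFinB leeB.
by apply: le_measure; rewrite ?inE//; exact: measurableC.
Qed.
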